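(* Let $u_h^{n+1}\in V_h$ and $\bar u_h^{n+1}\in\bar V_h$ be the velocity components of a solution of the fully-discrete problem (D1)--(D4) given in the context. Then $$\nabla\cdot u_h^{n+1}=0\qquad\forall x\in K,\ \forall K\in\mathcal T,$$ and $$\llbracket u_h^{n+1}\rrbracket=0\quad\forall x\in F,\ \forall F\in\mathcal F_I,\qquad\qquad u_h^{n+1}\cdot n=\bar u_h^{n+1}\cdot n\quad\forall x\in F,\ \forall F\in\mathcal F_B.$$
   Context: Setting. $\Omega\subset\mathbb R^d$ is a polygonal ($d=2$) or polyhedral ($d=3$) domain with outward unit normal $n$; $\partial\Omega=\Gamma_D\cup\Gamma_N$ with $\Gamma_D\cap\Gamma_N=\emptyset$; $\nu>0$ is the kinematic viscosity. $\mathcal T=\{K\}$ is a triangulation of $\Omega$ into non-overlapping simplices $K$; $n$ also denotes the outward unit normal on $\partial K$ (as a superscript, $n$ is the time-level index); $h_K$ is the size (diameter) of $K$. Two adjacent cells $K^+,K^-$ share an interior facet $F=\partial K^+\cap\partial K^-$; a facet of $\partial K$ lying on $\partial\Omega$ is a boundary facet. $\mathcal F_I$, $\mathcal F_B$ are the sets of interior and boundary facets, $\mathcal F=\mathcal F_I\cup\mathcal F_B$. On an interior facet the jump is $\llbracket a\rrbracket=a^+\cdot n^++a^-\cdot n^-$, where $a^\pm$ are the traces of $a$ from $K^\pm$ and $n^\pm$ is the outward unit normal on $\partial K^\pm$. Spaces. $P_l(D)$ denotes polynomials of degree (at most) $l$ on $D$, and $k\ge2$ is an integer. $V_h=\{v_h\in[L^2(\mathcal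 T)]^d: v_h|_K\in[P_k(K)]^d\ \forall K\in\mathcal T\}$; $\bar V_h=\{\bar v_h\in[L^2(\mathcal F)]^d:\bar v_h|_F\in[P_k(F)]^d\ \forall F\in\mathcal F,\ \bar v_h=0\text{ on }\Gamma_D\}$; $Q_h=\{q_h\in L^2(\mathcal T): q_h|_K\in P_{k-1}(K)\ \forall K\in\mathcal T\}$; $\bar Q_h=\{\bar q_h\in L^2(\mathcal F):\bar q_h|_F\in P_k(F)\ \forall F\in\mathcal F\}$. Functions in $\bar V_h,\bar Q_h$ live only on facets and are single-valued there; functions in $V_h,Q_h$ may be discontinuous across facets, and in integrals over $\partial K$ their traces from inside $K$ are used. Time discretization. $0=t^0<t^1<\dots<t^N$ are time levels, $\Delta t^n=t^{n+1}-t^n$, and for the parameter $\theta$ of the $\theta$-method, $y^{n+\theta}=(1-\theta)y^n+\theta y^{n+1}$. Fluxes. $(a\otimes b)_{ij}=a_ib_j$, $(\nabla u)_{ij}=\partial u_i/\partial x_j$, $\mathbb I$ is the identity tensor. $\sigma_h^{n+\theta}=\sigma_{a,h}^{n+\theta}+\sigma_{d,h}^{n+\theta}$ with $\sigma_{a,h}^{n+\theta}=u_h^{n+\theta}\otimes u_h^n$ and $\sigma_{d,h}^{n+\theta}=p_h^{n+\theta}\mathbb I-\nu\nabla u_h^{n+\theta}$. $\hat\sigma_h^{n+\theta}=\hat\sigma_{a,h}^{n+\theta}+\hat\sigma_{d,h}^{n+\theta}$ with $\hat\sigma_{a,h}^{n+\theta}=\sigma_{a,h}^{n+\theta}+(\bar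 u_h^{n+\theta}-u_h^{n+\theta})\otimes\lambda u_h^n$ and $\hat\sigma_{d,h}^{n+\theta}=\bar p_h^{n+\theta}\mathbb I-\nu\nabla u_h^{n+\theta}-\frac{\nu\alpha}{h_K}(\bar u_h^{n+\theta}-u_h^{n+\theta})\otimes n$, where $\lambda=1$ on parts of cell boundaries with $u_h^n\cdot n<0$, $\lambda=0$ where $u_h^n\cdot n\ge0$, and $\alpha>0$ is a penalty parameter. Fully-discrete problem: given $(u_h^n,\bar u_h^n,p_h^n,\bar p_h^n)\in V_h\times\bar V_h\times Q_h\times\bar Q_h$ at time $t^n$, $f^{n+\theta}\in[L^2(\Omega)]^d$ and $h^{n+\theta}\in[L^2(\Gamma_N)]^d$, find $(u_h^{n+1},\bar u_h^{n+1},p_h^{n+1},\bar p_h^{n+1})\in V_h\times\bar V_h\times Q_h\times\bar Q_h$ such that for all $(v_h,\bar v_h,q_h,\bar q_h)\in V_h\times\bar V_h\times Q_h\times\bar Q_h$: (D1) $0=\sum_K\int_Ku_h^{n+1}\cdot\nabla q_h\,dx-\sum_K\int_{\partial K}u_h^{n+1}\cdot n\,q_h\,ds$; (D2) $0=\sum_K\int_{\partial K}u_h^{n+1}\cdot n\,\bar q_h\,ds-\int_{\partial\Omega}\bar u_h^{n+1}\cdot n\,\bar q_h\,ds$; (D3) $\int_\Omega f^{n+\theta}\cdot v_h\,dx=\int_\Omega\frac{u_h^{n+1}-u_h^n}{\Delta t^n}\cdot v_h\,dx-\sum_K\int_K\sigma_h^{n+\theta}:\nabla v_h\,dx+\sum_K\int_{\partial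 K}\hat\sigma_h^{n+\theta}:(v_h\otimes n)\,ds+\sum_K\int_{\partial K}\nu\,((\bar u_h^{n+\theta}-u_h^{n+\theta})\otimes n):\nabla v_h\,ds$; (D4) $\int_{\Gamma_N}h^{n+\theta}\cdot\bar v_h\,ds=\sum_K\int_{\partial K}\hat\sigma_h^{n+\theta}:(\bar v_h\otimes n)\,ds-\int_{\Gamma_N}(1-\lambda)(\bar u_h^n\cdot n)\,\bar u_h^{n+\theta}\cdot\bar v_h\,ds$. *)

(* Defs.v *)
From HB Require Import structures.
From mathcomp Require Import all_boot all_order all_algebra.
From mathcomp Require Import all_classical all_reals all_analysis.
From mathcomp Require mpoly.
Set Implicit Arguments.
Unset Strict Implicit.
Unset Printing Implicit Defensive.
Import Order.TTheory GRing.Theory Num.Theory.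
Import numFieldNormedType.Exports.
Local Open Scope classical_set_scope.
Local Open Scope ring_scope.

Section tuple_measure.
Context d (T : measurableType d) (R : realType).

Definition tcons n (p : T * n.-tuple T) : n.+1.-tuple T := [tuple of p.1 :: p.2].

Section cons_measure.
Variable n : nat.
Variable m1 : {sigma_finite_measure set T -> \bar R}.
Variable m2 : {sigma_finite_measure set (n.-tuple T) -> \bar R}.

Definition cons_measure : set (n.+1.-tuple T) -> \bar R :=
  pushforward (m1 \x m2)%E (@tcons n).

Let measurable_tcons : measurable_fun setT (@tcons n).
Proof. exact: measurable_cons. Qed.

Let cons_measure0 : cons_measure set0 = 0%E.
Proof. exact: measure0. Qed.

Let cons_measure_ge0 A : (0 <= cons_measure A)%E.
Proof. exact: measure_ge0. Qed.

Let cons_measure_sigma_additive : semi_sigma_additive cons_measure.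
Proof. exact: measure_semi_sigma_additive. Qed.

HB.instance Definition _ := isMeasure.Build _ _ _ cons_measure
  cons_measure0 cons_measure_ge0 cons_measure_sigma_additive.

Let cons_measure_sigma_finite : sigma_finite setT cons_measure.
Proof.
have /sigma_finiteP[F [TF ndF Foo]] := sigma_finiteT m1.
have /sigma_finiteP[G [TG ndG Goo]] := sigma_finiteT m2.
pose u (t : n.+1.-tuple T) : T * n.-tuple T := (thead t, [tuple of behead t]).
have mu : measurable_fun setT u.
  apply/measurable_fun_pairP; split => /=.
    exact: measurable_tnth.
  exact: measurable_behead.
have uK p : u (tcons p) = p.
  by case: p => x t; congr pair; exact/val_inj.
have mFG k : measurable (F k `*` G k).
  by have [? _] := Foo k; have [? _] := Goo k; exact: measurableX.
exists (fun k => u @^-1` (F k `*` G k)).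
  apply/esym; rewrite -subTset => t _.
  have [i _ Fi] : (\bigcup_i F i) (thead t) by rewrite -TF.
  have [j _ Gj] : (\bigcup_i G i) [tuple of behead t] by rewrite -TG.
  exists (maxn i j) => //; split => /=.
    by move: (thead t) Fi; exact/subsetPset/ndF/leq_maxl.
  by move: [tuple of behead t] Gj; exact/subsetPset/ndG/leq_maxr.
move=> k; split.
  by rewrite -[X in measurable X]setTI; exact: mu.
rewrite /cons_measure /pushforward.
rewrite (_ : _ @^-1` _ = F k `*` G k); last first.
  by apply/funext => p; rewrite -[in RHS](uK p).
have [? ?] := Foo k; have [? ?] := Goo k.
by rewrite product_measure1E// lte_mul_pinfty// ge0_fin_numE.
Qed.

HB.instance Definition _ := @Measure_isSigmaFinite.Build _ _ _ cons_measure
  cons_measure_sigma_finite.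

End cons_measure.

Fixpoint tuple_measure (m : {sigma_finite_measure set T -> \bar R}) n :
    {sigma_finite_measure set (n.-tuple T) -> \bar R} :=
  match n with
  | 0 => \d_([tuple] : 0.-tuple T)
  | n'.+1 => cons_measure m (tuple_measure m n')
  end.

End tuple_measure.

Module PolyFun.
Import -(notations) mpoly.

(* Real polynomial functions on R^d of total degree at most [l]; [msize] is one
   more than the total degree. *)
Definition poly_fun (R : realType) (d l : nat) (g : 'rV[R]_d -> R) : Prop :=
  exists p : mpoly d R,
    (msize p <= l.+1)%N /\ forall x, g x = meval (fun i => x ord0 i) p.

End PolyFun.
Export PolyFun.

Section calculus.
Context {R : realType} {d : nat}.
Implicit Types (x y a b : 'rV[R]_d) (A B : 'M[R]_d).

Definition dotp a b : R := \sum_i a ord0 i * b ord0 i.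

Definition enorm a : R := Num.sqrt (dotp a a).

Definition otimes a b : 'M[R]_d := \matrix_(i, j) (a ord0 i * b ord0 j).

Definition ddot A B : R := \sum_i \sum_j A i j * B i j.

Definition gradient (q : 'rV[R]_d -> R) x : 'rV[R]_d := \row_j 'D_('e_j) q x.

Definition vgradient (u : 'rV[R]_d -> 'rV[R]_d) x : 'M[R]_d :=
  \matrix_(i, j) 'D_('e_j) (fun y => u y ord0 i) x.

Definition divergence (u : 'rV[R]_d -> 'rV[R]_d) x : R :=
  \sum_i 'D_('e_i) (fun y => u y ord0 i) x.

End calculus.

Section lebesgue.
Context (R : realType).
Notation RT := (measurableTypeR R).

(* Lebesgue measure on R^m, carried by the Borel space of m-tuples. *)
Definition lebesgue_tuple (m : nat) :
    {sigma_finite_measure set (m.-tuple RT) -> \bar R} :=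
  tuple_measure (@lebesgue_measure R) m.

Definition pt (d : nat) (t : d.-tuple RT) : 'rV[R]_d := \row_i tnth t i.

Definition vol_integral (d : nat) (D : set 'rV[R]_d) (g : 'rV[R]_d -> R) : R :=
  \int[lebesgue_tuple d]_(t in @pt d @^-1` D) g (pt t).

Definition square_integrable (m : nat) (D : set (m.-tuple RT))
    (g : m.-tuple RT -> R) : Prop :=
  measurable_fun D g /\
  (\int[lebesgue_tuple m]_(t in D) (g t ^+ 2)%:E < +oo)%E.

Definition ref_simplex (m : nat) : set (m.-tuple RT) :=
  [set t | (forall i, 0 <= (tnth t i : R)) /\ \sum_i (tnth t i : R) <= 1].

End lebesgue.

(* A cell is the set of its d+1 vertices; a facet is likewise a set of d
   vertices. *)
Record mesh (R : realType) (d : nat) := Mesh {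
  nvertex : nat;
  vertex : 'I_nvertex -> 'rV[R]_d;
  cells : {set {set 'I_nvertex}} }.

Section mesh.
Context {R : realType} {d : nat} (M : mesh R d) (Omega : set 'rV[R]_d).
Notation vset := {set 'I_(nvertex M)}.
Notation RT := (measurableTypeR R).
Implicit Types (K F S : vset) (x y : 'rV[R]_d).

Definition hull S : set 'rV[R]_d :=
  [set x | exists w : 'I_(nvertex M) -> R,
     [/\ forall i, 0 <= w i,
         \sum_(i in S) w i = 1 &
         x = \sum_(i in S) w i *: vertex i]].

Definition affinely_independent S : Prop :=
  forall w : 'I_(nvertex M) -> R,
    \sum_(i in S) w i = 0 -> \sum_(i in S) w i *: vertex i = 0 ->
    forall i, i \in S -> w i = 0.

Definition boundary : set 'rV[R]_d := closure Omega `\` interior Omega.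

(* [Omega] is a domain that lies on one side of its boundary (no slits); it is
   polygonal/polyhedral because its closure is the union of the cells. The last
   clause says that two cells meet in a common (possibly empty) face. *)
Definition triangulation : Prop :=
  [/\ [/\ Omega !=set0, open Omega, connected Omega &
          Omega = interior (closure Omega)],
      forall K, K \in cells M -> #|K| = d.+1 /\ affinely_independent K,
      closure Omega = \bigcup_(K in [set` cells M]) hull K &
      forall K L, K \in cells M -> L \in cells M ->
        hull K `&` hull L = hull (K :&: L)].

Definition interior_facet F : Prop :=
  exists K L, [/\ K \in cells M, L \in cells M, K != L, F = K :&: L & #|F| = d].

Definition boundary_facet F : Prop :=
  exists K v, [/\ K \in cells M, v \in K, F = K :\ v & hull F `<=` boundary].

Definition facet F : Prop := interior_facet F \/ boundary_facet F.

Definition diameter K : R :=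
  sup [set enorm (x - y) | x in hull K & y in hull K].

Definition is_outward_normal K F (n : 'rV[R]_d) : Prop :=
  [/\ dotp n n = 1,
      forall i j, i \in F -> j \in F -> dotp n (vertex i - vertex j) = 0 &
      forall i j, i \in K :\: F -> j \in F -> dotp n (vertex i - vertex j) < 0].

Definition normal K F : 'rV[R]_d := xget 0 [set n | is_outward_normal K F n].

Definition facet_point F (j : nat) : 'rV[R]_d := [seq vertex i | i <- enum F]`_j.

Definition facet_edge F (i : 'I_d.-1) : 'rV[R]_d :=
  facet_point F i.+1 - facet_point F 0.

Definition facet_param F (t : d.-1.-tuple RT) : 'rV[R]_d :=
  facet_point F 0 + \sum_i (tnth t i : R) *: facet_edge F i.

Definition facet_gram F : 'M[R]_d.-1 :=
  \matrix_(i, j) dotp (facet_edge F i) (facet_edge F j).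

(* Reference-simplex coordinates of the part of [F] inside [D]. *)
Definition facet_dom F (D : set 'rV[R]_d) : set (d.-1.-tuple RT) :=
  @ref_simplex R d.-1 `&` facet_param F @^-1` D.

(* Surface integral of [g] over the part of the facet [F] inside [D], through
   the affine parametrization of [F], with area element sqrt(det(Gram)). *)
Definition facet_integral F (D : set 'rV[R]_d) (g : 'rV[R]_d -> R) : R :=
  Num.sqrt (\det (facet_gram F)) *
  \int[lebesgue_tuple R d.-1]_(t in facet_dom F D) g (facet_param F t).

(* Integral over [Omega] of a function given cell by cell; the integrand is
   restricted to [Omega] since data such as f are only controlled there. *)
Definition domain_integral (g : vset -> 'rV[R]_d -> R) : R :=
  \sum_(K in cells M) vol_integral (hull K `&` Omega) (g K).

Definition cell_integrals (g : vset -> 'rV[R]_d -> R) : R :=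
  \sum_(K in cells M) vol_integral (hull K) (g K).

(* The facets of K are the sets [K :\ v], v a vertex of K. *)
Definition cell_boundary_integrals (g : vset -> vset -> 'rV[R]_d -> R) : R :=
  \sum_(K in cells M) \sum_(v in K) facet_integral (K :\ v) setT (g K (K :\ v)).

(* Integral over the part in [G] of the boundary of [Omega]; the outward unit
   normal of [Omega] on a boundary facet F of K is [normal K F]. *)
Definition boundary_integral (G : set 'rV[R]_d)
    (g : vset -> vset -> 'rV[R]_d -> R) : R :=
  \sum_(K in cells M) \sum_(v in K | `[< hull (K :\ v) `<=` boundary >])
     facet_integral (K :\ v) G (g K (K :\ v)).

(* Elements of the cell spaces are families, indexed by the cells K, of
   polynomial functions on R^d (the polynomial extension of the function on K);
   in this way the traces of the function and of its gradient from inside K are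
   its values. The values of the family at other vertex sets are irrelevant. *)
Definition cell_scalar := vset -> 'rV[R]_d -> R.
Definition cell_vector := vset -> 'rV[R]_d -> 'rV[R]_d.

(* Elements of the facet spaces are families indexed by the facets; only the
   values on the facet are meaningful. *)
Definition facet_scalar := vset -> 'rV[R]_d -> R.
Definition facet_vector := vset -> 'rV[R]_d -> 'rV[R]_d.

Definition jump (a : cell_vector) K L F x : R :=
  dotp (a K x) (normal K F) + dotp (a L x) (normal L F).

Definition poly_on (l : nat) (D : set 'rV[R]_d) (g : 'rV[R]_d -> R) : Prop :=
  exists2 p, poly_fun l p & forall x, D x -> g x = p x.

Definition in_Vh (k : nat) (v : cell_vector) : Prop :=
  forall K, K \in cells M -> forall i, poly_fun k (fun x => v K x ord0 i).

Definition in_Qh (k : nat) (q : cell_scalar) : Prop :=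
  forall K, K \in cells M -> poly_fun k.-1 (q K).

(* The condition on the Dirichlet part is an equality in L^2, that is, almost
   everywhere for the surface measure. *)
Definition in_Vbarh (k : nat) (GD : set 'rV[R]_d) (v : facet_vector) : Prop :=
  (forall F, facet F -> forall i, poly_on k (hull F) (fun x => v F x ord0 i)) /\
  (forall F, boundary_facet F ->
    (lebesgue_tuple R d.-1).-negligible
      (facet_dom F (GD `&` [set x | v F x <> 0]))).

Definition in_Qbarh (k : nat) (q : facet_scalar) : Prop :=
  forall F, facet F -> poly_on k (hull F) (q F).

Record state := State {
  vel : cell_vector;
  vbar : facet_vector;
  pre : cell_scalar;
  pbar : facet_scalar }.

Definition admissible (k : nat) (GD : set 'rV[R]_d) (s : state) : Prop :=
  [/\ in_Vh k (vel s), in_Vbarh k GD (vbar s), in_Qh k (pre s) &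
      in_Qbarh k (pbar s)].

Definition theta_avg (V : lmodType R) (theta : R) (y0 y1 : vset -> 'rV[R]_d -> V)
    : vset -> 'rV[R]_d -> V :=
  fun S x => (1 - theta) *: y0 S x + theta *: y1 S x.

Section scheme.
Variables (k : nat) (GD GN : set 'rV[R]_d).
Variables (nu alpha theta dt : R) (f h : 'rV[R]_d -> 'rV[R]_d).
Variables s0 s1 : state.

Let u := theta_avg theta (vel s0) (vel s1).
Let ub := theta_avg theta (vbar s0) (vbar s1).
Let p := theta_avg (V := R^o) theta (pre s0) (pre s1).
Let pb := theta_avg (V := R^o) theta (pbar s0) (pbar s1).

Definition upwind K F x : R :=
  if dotp (vel s0 K x) (normal K F) < 0 then 1 else 0.

Definition sigma_a K x : 'M[R]_d := otimes (u K x) (vel s0 K x).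

Definition sigma_d K x : 'M[R]_d := (p K x)%:M - nu *: vgradient (u K) x.

Definition sigma K x : 'M[R]_d := sigma_a K x + sigma_d K x.

Definition sigma_hat_a K F x : 'M[R]_d :=
  sigma_a K x + otimes (ub F x - u K x) (upwind K F x *: vel s0 K x).

Definition sigma_hat_d K F x : 'M[R]_d :=
  (pb F x)%:M - nu *: vgradient (u K) x
  - (nu * alpha / diameter K) *: otimes (ub F x - u K x) (normal K F).

Definition sigma_hat K F x : 'M[R]_d := sigma_hat_a K F x + sigma_hat_d K F x.

Definition continuity_eq : Prop := forall q, in_Qh k q ->
  0 = cell_integrals (fun K x => dotp (vel s1 K x) (gradient (q K) x))
      - cell_boundary_integrals (fun K F x =>
          dotp (vel s1 K x) (normal K F) * q K x).

Definition normal_flux_eq : Prop := forall qb, in_Qbarh k qb ->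
  0 = cell_boundary_integrals (fun K F x =>
        dotp (vel s1 K x) (normal K F) * qb F x)
      - boundary_integral setT (fun K F x =>
          dotp (vbar s1 F x) (normal K F) * qb F x).

Definition momentum_eq : Prop := forall v, in_Vh k v ->
  domain_integral (fun K x => dotp (f x) (v K x)) =
    domain_integral (fun K x =>
      dotp (dt^-1 *: (vel s1 K x - vel s0 K x)) (v K x))
    - cell_integrals (fun K x => ddot (sigma K x) (vgradient (v K) x))
    + cell_boundary_integrals (fun K F x =>
        ddot (sigma_hat K F x) (otimes (v K x) (normal K F)))
    + cell_boundary_integrals (fun K F x =>
        nu * ddot (otimes (ub F x - u K x) (normal K F)) (vgradient (v K) x)).

Definition momentum_flux_eq : Prop := forall vb, in_Vbarh k GD vb ->
  boundary_integral GN (fun K F x => dotp (h x) (vb F x)) =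
    cell_boundary_integrals (fun K F x =>
      ddot (sigma_hat K F x) (otimes (vb F x) (normal K F)))
    - boundary_integral GN (fun K F x =>
        (1 - upwind K F x) * dotp (vbar s0 F x) (normal K F)
        * dotp (ub F x) (vb F x)).

Definition fully_discrete_solution : Prop :=
  admissible k GD s1 /\
  [/\ continuity_eq, normal_flux_eq, momentum_eq & momentum_flux_eq].

End scheme.

Definition L2_domain (f : 'rV[R]_d -> 'rV[R]_d) : Prop :=
  forall i, square_integrable (@pt R d @^-1` Omega) (fun t => f (pt t) ord0 i).

Definition L2_boundary (GN : set 'rV[R]_d) (h : 'rV[R]_d -> 'rV[R]_d) : Prop :=
  forall F, boundary_facet F -> forall i,
    square_integrable (facet_dom F GN) (fun t => h (facet_param F t) ord0 i).

(* Both parts are Borel sets, so that integrals over them make sense. *)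
Definition boundary_partition (GD GN : set 'rV[R]_d) : Prop :=
  [/\ boundary = GD `|` GN, GD `&` GN = set0,
      measurable (@pt R d @^-1` GD) & measurable (@pt R d @^-1` GN)].

End mesh.

(* Main.v *)
Require Import Defs.
From HB Require Import structures.
From mathcomp Require Import all_boot all_order all_algebra perm.
From mathcomp Require Import all_classical all_reals all_analysis.
From mathcomp Require Import measurable_realfun ring lra.
From mathcomp Require mpoly.
Set Implicit Arguments.
Unset Strict Implicit.
Unset Printing Implicit Defensive.
Import Order.TTheory GRing.Theory Num.Theory.
Import numFieldNormedType.Exports.
Local Open Scope classical_set_scope.
Local Open Scope ring_scope.

(** The divergence of the velocity on a cell K has degree at most k-1, so it is an
    admissible test function [q] once extended by zero. Integration by parts on K
    turns the continuity equation into
    [int_K (div u)^2 = 0], and the divergence vanishes on K. Similarly, the jump of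
    the velocity on an interior facet F, extended by zero to the other facets, is an
    admissible test function in the flux equation. The two cells that share F give
    [int_F jump^2 = 0]; the boundary term does not see F. On a boundary facet the
    difference of the two normal traces plays the same role.

    Two facts carry this argument. The first is the divergence theorem for
    polynomials on a simplex ([cell_integral_derive]). An affine change of variables
    ([integral_affmap], proved by block elimination and Tonelli's theorem) reduces
    the derivative along an edge of K to a derivative in the first coordinate on the
    reference simplex, where the fundamental theorem of calculus applies
    ([integral_ref_derive0]); only the facets opposite to the two ends of the edge
    contribute. The constants match because the Jacobian of K is the area of a facet
    times the height of the opposite vertex ([cell_jac_normal]). The edges of K span
    all directions.

    The second is the geometry of a triangulation. A facet is contained in at most two
    cells ([at_most_two_cells]), and a facet of two cells is not contained in the
    boundary of the domain ([facet_not_boundary]). Both follow from barycentric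
    coordinates: two cells that meet exactly in a facet lie on opposite sides of it
    ([apex_coord_lt0]), since near the barycentre of the facet each of them fills the
    half-space on its side.

    Finally, a polynomial whose square has zero integral over a simplex vanishes at
    every point of it ([integral_ref_sqr_eq0]), so that the equalities hold
    everywhere and not just almost everywhere. *)

(** * Affine changes of variables for the Lebesgue measure of R^n *)

Section affine_line.
Context {R : realType}.
Notation RT := (measurableTypeR R).
Local Notation lam := (@lebesgue_measure R).
Implicit Types (a b : R) (A : set RT).

Lemma measurable_affine1 a b :
  measurable_fun setT ((fun x : RT => a * x + b) : RT -> RT).
Proof.
apply: (@measurable_funD _ _ _ _ (fun x : RT => a * (x : R)) (cst b)) => //.
exact: mulrl_measurable.
Qed.

(** Both sides are measures in [A], and they agree on half-open intervals. *)
Lemma lebesgue_measure_affine a b A : a != 0 -> measurable A ->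
  lam A = (`|a|%:E * lam ((fun x : RT => (a * x + b)%R : RT) @^-1` A))%E.
Proof.
move=> a0 mA.
have mf := measurable_affine1 a b.
pose m := mscale (NngNum (normr_ge0 a))
  (pushforward lam ((fun x : RT => a * x + b) : RT -> RT)).
suff : lam A = m mf A by [].
apply: lebesgue_measure_unique => //=.
move=> _ [[c d']] _ <- /=.
rewrite /mscale /= /pushforward /=.
have [a_gt0|a_lt0|a_eq0] := ltgtP 0 a; last by rewrite -a_eq0 eqxx in a0.
- rewrite (_ : _ @^-1` _ = [set` `](c - b) / a, (d' - b) / a]]); last first.
    apply/seteqP; split => x /=; rewrite !in_itv /= ltr_pdivrMr// ler_pdivlMr//.
      by case/andP => ? ?; apply/andP; split; lra.
    by case/andP => ? ?; apply/andP; split; lra.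
  rewrite !lebesgue_measure_itv /= !lte_fin ltr_pM2r ?invr_gt0// ltrD2r.
  case: ifP => cd; last by rewrite mule0.
  rewrite gtr0_norm//.
  rewrite !EFinN -!EFinB -EFinM; congr (_%:E).
  by field.
- rewrite (_ : _ @^-1` _ = [set` `[(d' - b) / a, (c - b) / a[]); last first.
    apply/seteqP; split => x /=; rewrite !in_itv /= ltr_ndivlMr// ler_ndivrMr//.
      by case/andP => ? ?; apply/andP; split; lra.
    by case/andP => ? ?; apply/andP; split; lra.
  rewrite !lebesgue_measure_itv /= !lte_fin ltr_nM2r ?invr_lt0// ltrD2r.
  case: ifP => cd; last by rewrite mule0.
  rewrite ltr0_norm//.
  rewrite !EFinN -!EFinB -EFinM; congr (_%:E).
  by field.
Qed.

Lemma ge0_integral_affine1 a b (g : RT -> \bar R) : a != 0 ->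
  measurable_fun setT g -> (forall x, 0 <= g x)%E ->
  (\int[lam]_x g (a * x + b)%R = (`|a|^-1)%:E * \int[lam]_x g x)%E.
Proof.
move=> a0 mg g0.
have mf := measurable_affine1 a b.
have -> : (\int[lam]_x g x = `|a|%:E *
    \int[pushforward lam ((fun x : RT => (a * x + b)%R) : RT -> RT)]_x g x)%E.
  rewrite -(ge0_integral_mscale _ _ (NngNum (normr_ge0 a)))//.
  apply: eq_measure_integral => /= A mA _.
  exact: lebesgue_measure_affine.
rewrite ge0_integral_pushforward//.
by rewrite muleA -EFinM mulVf ?normr_eq0// mul1e.
Qed.

End affine_line.

Section tuple_integral.
Context {R : realType}.
Notation RT := (measurableTypeR R).
Local Notation lam := (@lebesgue_measure R).
Local Notation Lam := (lebesgue_tuple R).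

(** The tuple of coordinates of a row vector, inverse to [pt]. *)
Definition tp n (x : 'rV[R]_n) : n.-tuple RT := [tuple (x ord0 i : RT) | i < n].

Lemma ptK n : cancel (@pt R n) (@tp n).
Proof. by move=> t; apply/eq_from_tnth => i; rewrite tnth_mktuple mxE. Qed.

Lemma tpK n : cancel (@tp n) (@pt R n).
Proof. by move=> x; apply/rowP => i; rewrite mxE tnth_mktuple. Qed.

Lemma measurable_tp d (T : measurableType d) n (f : T -> 'rV[R]_n) :
  (forall i, measurable_fun setT (fun x => f x ord0 i)) ->
  measurable_fun setT (fun x => tp (f x)).
Proof.
move=> mf; apply/measurable_fun_tnthP => i.
apply: (eq_measurable_fun (fun x => f x ord0 i)); last exact: mf.
by move=> x _ /=; rewrite tnth_mktuple.
Qed.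

Lemma measurable_pt_coord n i : measurable_fun setT (fun t : n.-tuple RT => pt t ord0 i : RT).
Proof.
apply: (eq_measurable_fun (fun t : n.-tuple RT => tnth t i)); last exact: measurable_tnth.
by move=> t _; rewrite mxE.
Qed.

Lemma measurable_tcons n : measurable_fun setT (@tcons _ RT n).
Proof. exact: measurable_cons. Qed.

(** Tonelli's theorem for the measure on (n+1)-tuples, which is the image of a
    product measure; the first coordinate is integrated last here, and first in
    the next lemma. *)
Lemma ge0_integral_tcons n (g : n.+1.-tuple RT -> \bar R) :
  measurable_fun setT g -> (forall t, 0 <= g t)%E ->
  (\int[Lam n.+1]_t g t = \int[lam]_x \int[Lam n]_t g (tcons (x, t)))%E.
Proof.
move=> mg g0.
have mt := @measurable_tcons n.
have -> : (\int[Lam n.+1]_t g t =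
    \int[pushforward (lam \x Lam n)%E (@tcons _ RT n)]_t g t)%E.
  by apply: eq_measure_integral.
rewrite ge0_integral_pushforward//.
by rewrite preimage_setT fubini_tonelli1//; [exact: measurableT_comp|
  move=> p; exact: g0].
Qed.

Lemma ge0_integral_tcons_swap n (g : n.+1.-tuple RT -> \bar R) :
  measurable_fun setT g -> (forall t, 0 <= g t)%E ->
  (\int[Lam n.+1]_t g t = \int[Lam n]_t \int[lam]_x g (tcons (x, t)))%E.
Proof.
move=> mg g0.
have mt := @measurable_tcons n.
have -> : (\int[Lam n.+1]_t g t =
    \int[pushforward (lam \x Lam n)%E (@tcons _ RT n)]_t g t)%E.
  by apply: eq_measure_integral.
rewrite ge0_integral_pushforward//.
by rewrite preimage_setT fubini_tonelli2//; [exact: measurableT_comp|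
  move=> p; exact: g0].
Qed.

Lemma pt_tcons n x (t : n.-tuple RT) :
  pt (tcons (x, t)) = row_mx (x : R)%:M (pt t) :> 'rV[R]_(1 + n).
Proof.
apply/rowP => i; rewrite !mxE.
case: splitP => j ij.
  rewrite !mxE (ord1 j) (_ : i = ord0) ?mulr1n//.
  by apply/val_inj; rewrite /= ij (ord1 j).
by rewrite mxE (_ : i = lift ord0 j) ?tnthS//; apply/val_inj.
Qed.

Lemma sum_tcons n x (t : n.-tuple RT) :
  \sum_i (tnth (tcons (x, t)) i : R) = (x : R) + \sum_i (tnth t i : R).
Proof.
by rewrite big_ord_recl; congr (_ + _); apply: eq_bigr => i _; rewrite tnthS.
Qed.

Lemma tp_row_mx n (x : 'rV[R]_1) (y : 'rV[R]_n) :
  tp (row_mx x y : 'rV_(n.+1)) = tcons (x ord0 ord0 : RT, tp y).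
Proof.
apply: (can_inj (@ptK n.+1)); rewrite tpK pt_tcons tpK.
by rewrite -mx11_scalar.
Qed.

End tuple_integral.

Section affine_change_of_variables.
Context {R : realType}.
Notation RT := (measurableTypeR R).
Local Notation lam := (@lebesgue_measure R).
Local Notation Lam := (lebesgue_tuple R).

(** The affine map x |-> x A + b on row vectors, read on tuples. *)
Definition affmap n m (A : 'M[R]_(n, m)) (b : 'rV[R]_m) (t : n.-tuple RT) :
  m.-tuple RT := tp (pt t *m A + b).

Lemma measurable_sumr d (T : measurableType d) (I : Type) (s : seq I)
    (D : set T) (f : I -> T -> R) :
  (forall i, measurable_fun D (f i)) ->
  measurable_fun D (fun x => \sum_(i <- s) f i x).
Proof.
move=> mf; elim: s => [|i s IH].
  by under eq_fun do rewrite big_nil; exact: measurable_cst.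
under eq_fun do rewrite big_cons.
exact: (@measurable_funD _ _ _ _ (f i)).
Qed.

Lemma measurable_affmap n m (A : 'M[R]_(n, m)) b :
  measurable_fun setT (affmap A b).
Proof.
apply: measurable_tp => i; under eq_fun do rewrite !mxE.
apply: (@measurable_funD _ _ _ _ (fun x => \sum_j _) (cst _)) => //.
apply: measurable_sumr => j.
apply: (@measurable_funM _ _ _ _ (fun t => pt t ord0 j) (cst _)) => //.
exact: measurable_pt_coord.
Qed.

Lemma pt_affmap n m (A : 'M[R]_(n, m)) b t : pt (affmap A b t) = pt t *m A + b.
Proof. exact: tpK. Qed.

Lemma affmap_comp n m p (A : 'M[R]_(n, m)) b (B : 'M[R]_(m, p)) c t :
  affmap B c (affmap A b t) = affmap (A *m B) (b *m B + c) t.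
Proof. by rewrite /affmap tpK mulmxDl mulmxA addrA. Qed.

(** The change of variables formula holds for all affine maps with linear part
    [A]. The translations are included, so that [scales 1%:M] is translation
    invariance. *)
Definition scales n (A : 'M[R]_n) := forall b (g : n.-tuple RT -> \bar R),
  measurable_fun setT g -> (forall t, 0 <= g t)%E ->
  (\int[Lam n]_t g (affmap A b t) = (`|\det A|^-1)%:E * \int[Lam n]_t g t)%E.

Lemma scalesM n (A B : 'M[R]_n) : scales A -> scales B -> scales (A *m B).
Proof.
move=> sA sB b g mg g0.
transitivity (\int[Lam n]_t (g \o affmap B b) (affmap A 0 t))%E.
  by apply: eq_integral => t _ /=; rewrite affmap_comp mul0mx add0r.
rewrite sA; [|by apply: measurableT_comp => //; exact: measurable_affmap|
  by move=> t; exact: g0].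
by rewrite sB// muleA -EFinM det_mulmx normrM invfM.
Qed.

Lemma affmap_tcons n (a : R) (r : 'rV[R]_n) (c : 'cV[R]_n) (D : 'M[R]_n)
    (b : 'rV[R]_(1 + n)) x t :
  affmap (block_mx a%:M r c D : 'M[R]_n.+1) (b : 'rV[R]_n.+1) (tcons (x, t)) =
  tcons ((x : R) * a + (pt t *m c) ord0 ord0 + b ord0 ord0 : RT,
         affmap D (x *: r + rsubmx b) t).
Proof.
have E : row_mx (x : R)%:M (pt t) *m block_mx a%:M r c D + b =
    row_mx ((x : R) * a + (pt t *m c) ord0 ord0 + b ord0 ord0)%:M
      (pt t *m D + (x *: r + rsubmx b)) :> 'rV_(1 + n).
  rewrite -[b in LHS]hsubmxK mul_row_block add_row_mx mul_scalar_mx.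
  congr row_mx; last by rewrite mul_scalar_mx [_ + pt t *m D]addrC addrA.
  apply/rowP => i; rewrite !(ord1 i) !mxE /= !mulr1n; congr (_ + b _ _).
  exact/val_inj.
rewrite /affmap pt_tcons; transitivity (tp (row_mx
    ((x : R) * a + (pt t *m c) ord0 ord0 + b ord0 ord0)%:M
      (pt t *m D + (x *: r + rsubmx b)) : 'rV[R]_n.+1)).
  by congr tp; exact: E.
by rewrite tp_row_mx mxE mulr1n.
Qed.

Lemma measurable_tcons1 n (t : n.-tuple RT) :
  measurable_fun setT (fun x : RT => tcons (x, t)).
Proof.
apply: (@measurable_cons _ _ _ _ id n (cst t)); first exact: measurable_id.
exact: measurable_cst.
Qed.

Lemma measurable_tcons2 n (x : RT) :
  measurable_fun setT (fun t : n.-tuple RT => tcons (x, t)).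
Proof.
apply: (@measurable_cons _ _ _ _ (cst x) n id); first exact: measurable_cst.
exact: measurable_id.
Qed.

(** The map changes the first coordinate only, once the others are translated:
    integrate first in that coordinate. *)
Lemma scales_first_coordinate n (a : R) (c : 'cV[R]_n) : a != 0 ->
  scales (1%:M : 'M[R]_n) ->
  scales (block_mx a%:M 0 c 1%:M : 'M[R]_n.+1).
Proof.
move=> a0 s1 b g mg g0.
have mgA : measurable_fun setT (g \o affmap (block_mx a%:M 0 c 1%:M : 'M[R]_n.+1) b).
  by apply: measurableT_comp => //; exact: measurable_affmap.
rewrite (ge0_integral_tcons_swap mgA (fun=> g0 _)) (ge0_integral_tcons_swap mg g0).
have mG : measurable_fun setT (fun t => \int[lam]_x g (tcons (x, t)))%E.
  apply: (measurable_fun_fubini_tonelli_G (m1 := lam) (g \o @tcons _ _ n)).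
    by apply: measurableT_comp => //; exact: measurable_tcons.
  by move=> x; exact: g0.
have G0 t : (0 <= \int[lam]_x g (tcons (x, t)))%E by apply: integral_ge0.
have ka : (0 <= (`|a|^-1)%:E)%E by rewrite lee_fin invr_ge0 normr_ge0.
transitivity (\int[Lam n]_t ((`|a|^-1)%:E *
  (\int[lam]_x g (tcons (x, affmap 1%:M (rsubmx (b : 'rV_(1 + n))) t)))))%E.
  apply: eq_integral => t _.
  have := @ge0_integral_affine1 R a ((pt t *m c) ord0 ord0 + b ord0 ord0)
    (fun x => g (tcons (x, affmap 1%:M (rsubmx (b : 'rV_(1 + n))) t))) a0.
  move=> <-//; last by apply: measurableT_comp => //; exact: measurable_tcons1.
  apply: eq_integral => x _ /=; rewrite affmap_tcons scaler0 add0r.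
  by rewrite mulrC addrA.
have mG' : measurable_fun setT (fun t : n.-tuple RT =>
    \int[lam]_x g (tcons (x, affmap 1%:M (rsubmx (b : 'rV_(1 + n))) t)))%E.
  by apply: (measurableT_comp mG); exact: measurable_affmap.
rewrite (ge0_integralZl (Lam n) measurableT mG' (fun _ _ => G0 _) ka).
have dE : \det (block_mx a%:M 0 c 1%:M : 'M[R]_n.+1) = a.
  by rewrite (det_lblock (a%:M : 'M[R]_1) c) det1 mulr1 det_scalar1.
by rewrite (s1 _ _ mG G0) det1 normr1 invr1 mul1e dE.
Qed.

(** The map keeps the first coordinate up to a translation; for a fixed first
    coordinate it acts on the others through [D]. *)
Lemma scales_last_coordinates n (r : 'rV[R]_n) (D : 'M[R]_n) : scales D ->
  scales (block_mx 1%:M r 0 D : 'M[R]_n.+1).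
Proof.
move=> sD b g mg g0.
have mgA : measurable_fun setT (g \o affmap (block_mx 1%:M r 0 D : 'M[R]_n.+1) b).
  by apply: measurableT_comp => //; exact: measurable_affmap.
rewrite (ge0_integral_tcons mgA (fun=> g0 _)) (ge0_integral_tcons mg g0).
have mG : measurable_fun setT (fun x => \int[Lam n]_t g (tcons (x, t)))%E.
  apply: (measurable_fun_fubini_tonelli_F (m2 := Lam n) (g \o @tcons _ _ n)).
    by apply: measurableT_comp => //; exact: measurable_tcons.
  by move=> x; exact: g0.
have G0 x : (0 <= \int[Lam n]_t g (tcons (x, t)))%E by apply: integral_ge0.
have ka : (0 <= (`|\det D|^-1)%:E)%E by rewrite lee_fin invr_ge0 normr_ge0.
transitivity (\int[lam]_x ((`|\det D|^-1)%:E *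
  (\int[Lam n]_t (g (tcons ((1 * x + b ord0 ord0)%R : RT, t))))))%E.
  apply: eq_integral => x _.
  rewrite -(sD (x *: r + rsubmx (b : 'rV_(1 + n)))
              (fun t => g (tcons ((1 * x + b ord0 ord0)%R : RT, t)))) //.
    by apply: eq_integral => t _ /=; rewrite affmap_tcons mulmx0 mxE addr0 mulr1 mul1r.
  by apply: measurableT_comp => //; exact: measurable_tcons2.
have mG' : measurable_fun setT (fun x : RT =>
    \int[Lam n]_t (g (tcons ((1 * x + b ord0 ord0)%R : RT, t))))%E.
  by apply: (measurableT_comp mG); exact: measurable_affine1.
rewrite (ge0_integralZl lam measurableT mG' (fun _ _ => G0 _) ka).
rewrite (@ge0_integral_affine1 _ 1 (b ord0 ord0) _ (oner_neq0 _) mG G0).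
have dE : \det (block_mx 1%:M r 0 D : 'M[R]_n.+1) = \det D.
  by rewrite (det_ublock (1%:M : 'M[R]_1) r) det1 mul1r.
by rewrite dE normr1 invr1 mul1e.
Qed.

(** Induction on the dimension: an invertible matrix is a product of matrices of
    the two kinds above. *)
Lemma scales_unitmx n (A : 'M[R]_n) : \det A != 0 -> scales A.
Proof.
elim: n A => [|n IH] A dA.
  move=> b g mg g0; rewrite det_mx00 normr1 invr1 mul1e.
  by apply: eq_integral => t _; congr g; apply/eq_from_tnth => -[].
have s1 : scales (1%:M : 'M[R]_n) by apply: IH; rewrite det1 oner_eq0.
(* With a nonzero upper left entry, block elimination factors the matrix; [D] is
   the Schur complement of that entry. *)
have pivot (B : 'M[R]_(1 + n)) : \det B != 0 -> B ord0 ord0 != 0 ->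
    scales (B : 'M[R]_n.+1).
  move=> dB b0.
  set a := B ord0 ord0 in b0.
  have ulE : ulsubmx B = a%:M.
    by rewrite [ulsubmx B]mx11_scalar !mxE; congr (B _ _)%:M; apply/val_inj.
  pose D := drsubmx B - a^-1 *: (dlsubmx B *m ursubmx B).
  have BE : B = block_mx a%:M 0 (dlsubmx B) 1%:M *m
                block_mx 1%:M (a^-1 *: ursubmx B) 0 D.
    rewrite mulmx_block !mulmx0 !mulmx1 !mul0mx !mul1mx !addr0 mul_scalar_mx.
    by rewrite scalerA divff// scale1r -scalemxAr addrC subrK -ulE submxK.
  have dD : \det D != 0.
    apply: contraNneq dB => dD.
    by rewrite BE det_mulmx det_ublock dD !mulr0.
  rewrite BE; apply: scalesM.
    exact: scales_first_coordinate.
  by apply: scales_last_coordinates; exact: IH.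
have [A0|] := eqVneq ((A : 'M[R]_(1 + n)) ord0 ord0) 0; last exact: pivot.
have [j Aj] : exists j : 'I_n, dlsubmx (A : 'M[R]_(1 + n)) j ord0 != 0.
  apply/existsP; rewrite -negb_forall; apply: contraNN dA => /forallP A1.
  rewrite (expand_det_col _ ord0) big1// => i _.
  suff -> : A i ord0 = 0 by rewrite mul0r.
  have [j ->|->//] := unliftP ord0 i.
  move: (A1 j) => /eqP <-; rewrite !mxE.
  by congr (A _ _); apply/val_inj.
(* Adding row [j] to the first row produces a nonzero upper left entry. *)
pose E (s : R) : 'M[R]_(1 + n) := block_mx 1%:M (s *: delta_mx 0 j) 0 1%:M.
have EA : A = E (-1) *m (E 1 *m A).
  rewrite mulmxA mulmx_block !mulmx0 !mulmx1 !mul0mx !mul1mx !addr0 add0r.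
  by rewrite -scalerDl subrr scale0r -scalar_mx_block mul1mx.
rewrite EA; apply: scalesM; first exact: scales_last_coordinates.
apply: pivot.
  by rewrite det_mulmx mulf_neq0// det_ublock !det1 mulr1 oner_neq0.
pose B : 'M[R]_(1 + n) := A.
change ((E 1 *m B) ord0 ord0 != 0).
have -> : (E 1 *m B) ord0 ord0 = ulsubmx (E 1 *m B) ord0 ord0.
  by rewrite !mxE; apply: eq_bigr => k _; congr (E _ _ _ * B _ _); apply/val_inj.
rewrite -[X in E 1 *m X]submxK mulmx_block block_mxKul.
rewrite mul1mx scale1r -rowE !mxE.
suff -> : B (lshift n ord0) (lshift n ord0) = 0 by rewrite add0r; move: Aj; rewrite !mxE.
by rewrite -[RHS]A0; congr (A _ _); apply/val_inj.
Qed.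

Lemma ge0_integral_affmap n (A : 'M[R]_n) (b : 'rV[R]_n) (g : n.-tuple RT -> \bar R) :
  \det A != 0 -> measurable_fun setT g -> (forall t, 0 <= g t)%E ->
  (\int[Lam n]_t g t = `|\det A|%:E * \int[Lam n]_t g (affmap A b t))%E.
Proof.
move=> dA mg g0; rewrite (scales_unitmx dA b mg g0) muleA -EFinM mulfV ?normr_eq0//.
by rewrite mul1e.
Qed.

Lemma fine_pMl (d : R) (x : \bar R) : 0 < d -> fine (d%:E * x)%E = d * fine x.
Proof.
move=> d0; case: x => [x| |] //=.
  by rewrite gt0_muley ?lte_fin//= mulr0.
by rewrite gt0_muleNy ?lte_fin//= mulr0.
Qed.

Lemma pmuleBr (d : R) (x y : \bar R) : 0 < d ->
  (d%:E * (x - y) = d%:E * x - d%:E * y)%E.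
Proof.
move=> d0; case: x => [x| |]; case: y => [y| |] /=;
  rewrite ?gt0_muley ?gt0_muleNy ?lte_fin//=.
by rewrite -EFinM -EFinM -EFinB mulrBr.
Qed.

Lemma integral_affmap n (A : 'M[R]_n) (b : 'rV[R]_n) (D : set (n.-tuple RT))
    (g : n.-tuple RT -> R) :
  \det A != 0 -> measurable D -> measurable_fun setT g ->
  \int[Lam n]_(t in D) g t =
  `|\det A| * \int[Lam n]_(t in affmap A b @^-1` D) g (affmap A b t).
Proof.
move=> dA mD mg; rewrite Rintegral_mkcond [in RHS]Rintegral_mkcond.
set f := g \_ D.
have mf : measurable_fun setT f by apply/(measurable_restrictT _ mD)/measurable_funTS.
have -> : (fun t => g (affmap A b t)) \_ (affmap A b @^-1` D) =
          f \o affmap A b.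
  by apply/funext => t; rewrite /f /patch /=; congr (if _ then _ else _);
    apply/idP/idP => /set_mem ?; exact: mem_set.
rewrite /Rintegral.
have d0 : 0 < `|\det A| by rewrite normr_gt0.
rewrite -(fine_pMl _ d0); congr fine.
rewrite integralE [in RHS]integralE (pmuleBr _ _ d0); congr (_ - _)%E.
  rewrite (@ge0_integral_affmap _ A b ((EFin \o f)^\+)%E dA)//.
    by congr (_ * _)%E; apply: eq_integral => t _; rewrite !funeposE.
  exact/measurable_funepos/measurable_EFinP.
rewrite (@ge0_integral_affmap _ A b ((EFin \o f)^\-)%E dA)//.
  by congr (_ * _)%E; apply: eq_integral => t _; rewrite !funenegE.
exact/measurable_funeneg/measurable_EFinP.
Qed.

Lemma measurable_affmap_preimage n m (A : 'M[R]_(n, m)) b D : measurable D ->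
  measurable (affmap A b @^-1` D).
Proof. by move=> mD; rewrite -[X in measurable X]setTI; exact: measurable_affmap. Qed.

End affine_change_of_variables.

(** * Polynomial functions *)

Section polynomial_functions.
Context {R : realType}.
Notation RT := (measurableTypeR R).

(** Polynomial functions, without any control of the degree: the functions built
    from constants and coordinates by sums and products. *)
Inductive polyf (d : nat) : ('rV[R]_d -> R) -> Prop :=
| polyf_cst c : polyf (fun=> c)
| polyf_coord i : polyf (fun x => x ord0 i)
| polyfD f g : polyf f -> polyf g -> polyf (fun x => f x + g x)
| polyfM f g : polyf f -> polyf g -> polyf (fun x => f x * g x).

Lemma polyf_sum d (I : Type) (s : seq I) (f : I -> 'rV[R]_d -> R) :
  (forall i, polyf (f i)) -> polyf (fun x => \sum_(i <- s) f i x).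
Proof.
move=> pf; elim: s => [|i s IH].
  rewrite (_ : (fun _ => _) = fun=> 0); first exact: polyf_cst.
  by apply/funext => x; rewrite big_nil.
rewrite (_ : (fun _ => _) = fun x => f i x + \sum_(j <- s) f j x).
  exact: polyfD.
by apply/funext => x; rewrite big_cons.
Qed.

Lemma polyf_prod d (I : Type) (s : seq I) (f : I -> 'rV[R]_d -> R) :
  (forall i, polyf (f i)) -> polyf (fun x => \prod_(i <- s) f i x).
Proof.
move=> pf; elim: s => [|i s IH].
  rewrite (_ : (fun _ => _) = fun=> 1); first exact: polyf_cst.
  by apply/funext => x; rewrite big_nil.
rewrite (_ : (fun _ => _) = fun x => f i x * \prod_(j <- s) f j x).
  exact: polyfM.
by apply/funext => x; rewrite big_cons.
Qed.

Lemma polyfX d (f : 'rV[R]_d -> R) k : polyf f -> polyf (fun x => f x ^+ k).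
Proof.
move=> pf; elim: k => [|k IH].
  rewrite (_ : (fun _ => _) = fun=> 1); first exact: polyf_cst.
  by apply/funext => x; rewrite expr0.
rewrite (_ : (fun _ => _) = fun x => f x * f x ^+ k); first exact: polyfM.
by apply/funext => x; rewrite exprS.
Qed.

Lemma polyfB d (f g : 'rV[R]_d -> R) :
  polyf f -> polyf g -> polyf (fun x => f x - g x).
Proof.
move=> pf pg; rewrite (_ : (fun _ => _) = fun x => f x + (-1) * g x).
  by apply: polyfD => //; apply: polyfM => //; exact: polyf_cst.
by apply/funext => x; rewrite mulN1r.
Qed.

Lemma polyf_affine d e (A : 'M[R]_(d, e)) (b : 'rV[R]_e) (f : 'rV[R]_e -> R) :
  polyf f -> polyf (fun x => f (x *m A + b)).
Proof.
elim=> [c|i|g h _ pg _ ph|g h _ pg _ ph]; [exact: polyf_cst| |exact: polyfD|exact: polyfM].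
rewrite (_ : (fun _ => _) = fun x : 'rV[R]_d => \sum_j x ord0 j * A j i + b ord0 i); last first.
  by apply/funext => x; rewrite !mxE.
apply: polyfD; last exact: polyf_cst.
by apply: polyf_sum => j; apply: polyfM; [exact: polyf_coord|exact: polyf_cst].
Qed.

Lemma polyf_measurable d (f : 'rV[R]_d -> R) :
  polyf f -> measurable_fun setT (fun t : d.-tuple RT => f (pt t)).
Proof.
elim=> [c|i|g h _ pg _ ph|g h _ pg _ ph].
- exact: measurable_cst.
- exact: measurable_pt_coord.
- exact: measurable_funD.
- exact: measurable_funM.
Qed.

Lemma polyf_bounded d (f : 'rV[R]_d -> R) : polyf f ->
  forall c : R, exists B : R, forall x : 'rV[R]_d, (forall i, `|x ord0 i| <= c) -> `|f x| <= B.
Proof.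
elim=> [b c|i c|g h _ pg _ ph c|g h _ pg _ ph c].
- by exists `|b|.
- by exists c.
- have [B hB] := pg c; have [C hC] := ph c.
  by exists (B + C) => x hx; rewrite (le_trans (ler_normD _ _))// lerD ?hB ?hC.
- have [B hB] := pg c; have [C hC] := ph c.
  by exists (B * C) => x hx; rewrite normrM ler_pM ?hB ?hC.
Qed.

Lemma polyf_continuous d (f : 'rV[R]_d -> R) : polyf f -> continuous f.
Proof.
elim=> [c x|i|g h _ pg _ ph x|g h _ pg _ ph x].
- exact: cst_continuous.
- exact: coord_continuous.
- by apply: (@continuousD _ _ _ g h x); [exact: pg|exact: ph].
- by apply: (@continuousM _ _ g h x); [exact: pg|exact: ph].
Qed.

Lemma is_derive_coord d (i : 'I_d) (x v : 'rV[R]_d) :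
  is_derive x v (fun y : 'rV[R]_d => y ord0 i) (v ord0 i).
Proof.
have L : (fun h : R => h^-1 *: ((h *: v + x) ord0 i - x ord0 i)) @ 0^' --> v ord0 i.
  apply: cvg_near_cst; near=> h.
  by rewrite !mxE addrK; apply: mulKf; near: h; exact: nbhs_dnbhs_neq.
by apply: DeriveDef; [apply/cvg_ex; exists (v ord0 i)|apply/cvg_lim].
Unshelve. all: by end_near. Qed.

(** Derivatives exist and are again polynomial; the two facts are proved together
    because the derivative of a product involves the factors. *)
Lemma polyf_derivable d (f : 'rV[R]_d -> R) : polyf f ->
  forall v : 'rV[R]_d, (forall x, derivable f x v) /\ polyf ('D_v f).
Proof.
elim=> [c v|i v|g h _ pg _ ph v|g h Pg pg Ph ph v].
- split=> [x|]; first exact: derivable_cst.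
  rewrite (_ : 'D_v _ = fun=> 0); first exact: polyf_cst.
  by apply/funext => x; rewrite derive_cst.
- have D x := is_derive_coord i x v.
  split=> [x|]; first by have [] := D x.
  rewrite (_ : 'D_v _ = fun=> v ord0 i); first exact: polyf_cst.
  by apply/funext => x; have [] := D x.
- have [dg pdg] := pg v; have [dh pdh] := ph v; split=> [x|].
    exact: derivableD.
  rewrite (_ : 'D_v _ = fun x => 'D_v g x + 'D_v h x); first exact: polyfD.
  by apply/funext => x; rewrite deriveD.
- have [dg pdg] := pg v; have [dh pdh] := ph v; split=> [x|].
    exact: derivableM.
  rewrite (_ : 'D_v _ = fun x => g x * 'D_v h x + h x * 'D_v g x).
    by apply: polyfD; apply: polyfM.
  by apply/funext => x; rewrite deriveM.
Qed.

Lemma polyf_derive d (f : 'rV[R]_d -> R) v : polyf f -> polyf ('D_v f).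
Proof. by move=> /polyf_derivable /(_ v)[]. Qed.

Lemma derive_affine d e (A : 'M[R]_(d, e)) (b : 'rV[R]_e) (f : 'rV[R]_e -> R) x v :
  'D_v (fun y => f (y *m A + b)) x = 'D_(v *m A) f (x *m A + b).
Proof.
have E : (fun h : R => h^-1 *: (f ((h *: v + x) *m A + b) - f (x *m A + b))) =
    (fun h : R => h^-1 *: (f (h *: (v *m A) + (x *m A + b)) - f (x *m A + b))).
  by apply/funext => h; rewrite mulmxDl -scalemxAl addrA.
exact: (congr1 (fun F : R -> R^o => lim (F h @[h --> 0^'])) E).
Qed.

(** Directional derivatives are derivatives along lines. *)
Lemma derive_line d (f : 'rV[R]_d -> R) (x v : 'rV[R]_d) (s : R) :
  derivable f (s *: v + x) v ->
  is_derive s 1 (fun r : R => f (r *: v + x)) ('D_v f (s *: v + x)).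
Proof.
have E : (fun h : R => h^-1 *: (f (h *: v + (s *: v + x)) - f (s *: v + x))) =
    (fun h : R => h^-1 *: (f ((h *: (1 : R) + s) *: v + x) - f (s *: v + x))).
  by apply/funext => h; rewrite [_%:A]mulr1 scalerDl addrA.
move=> df; apply: DeriveDef.
  exact: (eq_ind _ (fun F : R -> R^o => cvg (F h @[h --> 0^'])) df _ E).
exact: (esym (congr1 (fun F : R -> R^o => lim (F h @[h --> 0^'])) E)).
Qed.

Lemma polyf_derivative_sum d (f : 'rV[R]_d -> R) (v x : 'rV[R]_d) : polyf f ->
  'D_v f x = \sum_j v ord0 j * 'D_('e_j) f x.
Proof.
elim=> [c|i|g h Pg pg Ph ph|g h Pg pg Ph ph].
- by rewrite derive_cst big1// => j _; rewrite derive_cst mulr0.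
- have D w : 'D_w (fun y : 'rV[R]_d => y ord0 i) x = w ord0 i.
    by have [] := is_derive_coord i x w.
  rewrite D (bigD1 i)//= D big1 ?addr0 => [|j ji].
    by rewrite mxE !eqxx mulr1.
  by rewrite D mxE eqxx [i == j]eq_sym (negPf ji) mulr0.
- have dg w := (polyf_derivable Pg w).1 x.
  have dh w := (polyf_derivable Ph w).1 x.
  rewrite (deriveD (dg _) (dh _)) pg ph -big_split; apply: eq_bigr => j _ /=.
  by rewrite (deriveD (dg _) (dh _)) mulrDr.
- have dg w := (polyf_derivable Pg w).1 x.
  have dh w := (polyf_derivable Ph w).1 x.
  rewrite (deriveM (dg _) (dh _)) pg ph.
  rewrite /GRing.scale /= !mulr_sumr -big_split; apply: eq_bigr => j _ /=.
  by rewrite (deriveM (dg _) (dh _)) /GRing.scale /=; ring.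
Qed.

End polynomial_functions.

(** The degree-bounded polynomial functions [poly_fun]; differentiation lowers the
    bound by one. *)
Module PolyFunTheory.
Import -(notations) mpoly.

Section theory.
Context {R : realType} {d : nat}.
Implicit Types (g : 'rV[R]_d -> R) (p : mpoly d R).

Let ev (x : 'rV[R]_d) (p : mpoly d R) : R := meval (fun i => x ord0 i) p.

Let polyf_ev p : polyf (fun x => ev x p).
Proof.
rewrite (_ : (fun _ => _) = fun x : 'rV[R]_d =>
    \sum_(m <- msupp p) mcoeff m p * \prod_i x ord0 i ^+ m i); last first.
  by apply/funext => x; rewrite /ev mevalE.
apply: polyf_sum => m; apply: polyfM; first exact: polyf_cst.
apply: polyf_prod => i; apply: polyfX; exact: polyf_coord.
Qed.

Lemma poly_fun_polyf l g : poly_fun l g -> polyf g.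
Proof.
case=> p [_ gE]; rewrite (_ : g = fun x => ev x p); first exact: polyf_ev.
exact/funext.
Qed.

Lemma poly_fun0 l : poly_fun l (fun _ : 'rV[R]_d => 0 : R).
Proof. by exists 0; split => [|x]; rewrite ?mmeasure0// meval0. Qed.

Lemma poly_funD l f g : poly_fun l f -> poly_fun l g ->
  poly_fun l (fun x => f x + g x).
Proof.
move=> [p [sp fE]] [q [sq gE]]; exists (p + q); split=> [|x].
  by rewrite (leq_trans (mmeasureD_le _ _ _))// geq_max sp.
by rewrite mevalD fE gE.
Qed.

Lemma poly_funZ l (c : R) g : poly_fun l g -> poly_fun l (fun x => c * g x).
Proof.
move=> [p [sp gE]]; exists (c *: p); split=> [|x].
  by rewrite (leq_trans (mmeasureZ_le _ _ _)).
by rewrite mevalZ gE.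
Qed.

Lemma poly_fun_sum l (I : Type) (s : seq I) (f : I -> 'rV[R]_d -> R) :
  (forall i, poly_fun l (f i)) -> poly_fun l (fun x => \sum_(i <- s) f i x).
Proof.
move=> pf; elim: s => [|i s IH].
  rewrite (_ : (fun _ => _) = fun=> 0); first exact: poly_fun0.
  by apply/funext => x; rewrite big_nil.
rewrite (_ : (fun _ => _) = fun x => f i x + \sum_(j <- s) f j x).
  exact: poly_funD.
by apply/funext => x; rewrite big_cons.
Qed.

Let has_deriv i p := forall x, 'D_('e_i) (fun x => ev x p) x = ev x (mderiv i p).

Let dable p x v : derivable (fun x => ev x p) x v.
Proof. by have [] := polyf_derivable (polyf_ev p) v. Qed.

Let has_derivD i p q : has_deriv i p -> has_deriv i q -> has_deriv i (p + q).
Proof.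
move=> hp hq x.
rewrite (_ : (fun x => _) = fun y => ev y p + ev y q); last first.
  by apply/funext => y; exact: mevalD.
by rewrite (deriveD (@dable p x _) (@dable q x _)) hp hq mderivD [RHS]mevalD.
Qed.

Let has_derivZ i (c : R) p : has_deriv i p -> has_deriv i (c *: p).
Proof.
move=> hp x.
rewrite (_ : (fun x => _) = fun y => c * ev y p); last first.
  by apply/funext => y; exact: mevalZ.
rewrite [LHS](@deriveZ _ _ _ (fun x => ev x p) c _ _ (@dable p x _)) hp mderivZ.
by rewrite [RHS]mevalZ.
Qed.

Let has_derivM i p q : has_deriv i p -> has_deriv i q -> has_deriv i (p * q).
Proof.
move=> hp hq x; rewrite mderivM {2}/ev mevalD !mevalM -!/(ev _ _) -hp -hq.
rewrite (_ : (fun x => _) = fun y => ev y p * ev y q); last first.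
  by apply/funext => y; exact: mevalM.
rewrite (deriveM (@dable p x _) (@dable q x _)) addrC; congr (_ + _).
exact: mulrC.
Qed.

Let has_deriv1 i : has_deriv i 1.
Proof.
move=> x; rewrite -mpolyC1 mderivC /ev meval0.
rewrite (_ : (fun x => _) = fun=> 1) ?derive_cst//.
by apply/funext => y; exact: mevalC.
Qed.

Let has_derivX i m : has_deriv i (mpolyX R m).
Proof.
rewrite mpolyXE_id; apply: (big_ind (has_deriv i)) => [||j _].
- exact: has_deriv1.
- exact: has_derivM.
- elim: (m j) => [|k IH]; first by rewrite expr0; exact: has_deriv1.
  rewrite exprS; apply: has_derivM => // x.
  rewrite (_ : (fun x => _) = fun y : 'rV[R]_d => y ord0 j); last first.
    by apply/funext => y; exact: mevalXU.
  have [_ ->] := is_derive_coord j x 'e_i.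
  rewrite mderivX /ev mevalZ mnm1E mxE eqxx eq_sym.
  have [->|] := eqVneq i j; last by rewrite mul0r.
  by rewrite (_ : mnm_sub _ _ = mnm0) ?mpolyX0 ?meval1 ?mulr1//;
    apply/mnmP => h; rewrite mnmBE subnn mnm0E.
Qed.

Let mderiv_correct i p : has_deriv i p.
Proof.
elim/mpolyind: p => [x|c m p _ _ IH].
  rewrite mderiv0 /ev meval0.
  rewrite (_ : (fun x => _) = fun=> 0) ?derive_cst//.
  by apply/funext => y; exact: meval0.
by apply: has_derivD => //; apply: has_derivZ; exact: has_derivX.
Qed.

Lemma poly_fun_derive l i g : poly_fun l.+1 g -> poly_fun l ('D_('e_i) g).
Proof.
move=> [p [sp gE]]; exists (mderiv i p); split; last first.
  rewrite (_ : g = fun y => ev y p); first exact: mderiv_correct.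
  exact/funext.
rewrite /mderiv big_seq; apply: (leq_trans (mmeasure_sum _ _ _ _)).
apply/bigmax_leqP_seq => m ms _.
have [mi0|mi0] := eqVneq (m i) 0%N.
  by rewrite mi0 mul0r scale0r mmeasure0.
rewrite (leq_trans (mmeasureZ_le _ _ _))// mmeasureX.
have mdm : (mdeg m <= l.+1)%N := leq_trans (msize_mdeg_lt ms) sp.
apply: leq_trans mdm; rewrite -[X in (_ < mdeg X)%N](@submK _ (mnm1 i)) ?mdegD ?mdeg1 ?addn1//.
apply/mnm_lepP => j; rewrite mnm1E; case: eqP => // <-.
by rewrite lt0n.
Qed.

End theory.
End PolyFunTheory.
Import PolyFunTheory.

(** * Integration over the reference simplex *)

Section reference_simplex.
Context {R : realType}.
Notation RT := (measurableTypeR R).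
Local Notation lam := (@lebesgue_measure R).
Local Notation Lam := (lebesgue_tuple R).
Local Notation ref m := (@ref_simplex R m).

Lemma measurable_ref m : measurable (ref m).
Proof.
rewrite (_ : ref m = (\bigcap_(i in [set: 'I_m]) [set t : m.-tuple RT | 0 <= (tnth t i : R)]) `&`
    [set t : m.-tuple RT | \sum_i (tnth t i : R) <= 1]); last first.
  by apply/seteqP; split => [t [t0 t1]|t [t0 t1]]; split => // i; [move=> _|]; exact: t0.
apply: measurableI.
  apply: fin_bigcap_measurable => [|i _]; first exact: finite_finset.
  rewrite -[X in measurable X]setTI.
  rewrite (_ : [set _ | _] = (fun t : m.-tuple RT => tnth t i : R) @^-1` `[0, +oo[).
    exact: measurable_tnth.
  by apply/seteqP; split => t /=; rewrite in_itv /= andbT.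
rewrite -[X in measurable X]setTI.
rewrite (_ : [set _ | _] = (fun t : m.-tuple RT => \sum_i (tnth t i : R)) @^-1` `]-oo, 1]).
  by apply: (@measurable_sumr _ _ _ _ _ setT) => // i; exact: measurable_tnth.
by apply/seteqP; split => t /=; rewrite in_itv.
Qed.

Arguments measurable_ref : clear implicits.

(* The cube [0, c]^m. *)
Let box m (c : R) : set (m.-tuple RT) :=
  [set t | forall i, (tnth t i : R) \in `[0, c]].
Arguments box : clear implicits.

Let box_tcons m c : @tcons _ RT m @^-1` box m.+1 c = [set` `[0, c]] `*` box m c.
Proof.
apply/seteqP; split => -[x t] /=.
  by move=> h; split => [|i]; [exact: (h ord0)|have := h (lift ord0 i); rewrite tnthS].
by case=> h1 h2 i; have [j ->|->//] := unliftP ord0 i; rewrite tnthS.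
Qed.

Let lebesgue_box m (c : R) : 0 <= c -> measurable (box m c) /\ Lam m (box m c) = (c ^+ m)%:E.
Proof.
move=> c0; elim: m => [|m [mb IH]].
  rewrite (_ : box 0 c = setT); last by apply/seteqP; split => // t _ [].
  by split=> //; rewrite /= diracT.
have mb' : measurable (box m.+1 c).
  rewrite (_ : box _ _ = \bigcap_(i in [set: 'I_m.+1]) ((@tnth _ RT ^~ i) @^-1` `[0, c])).
    apply: fin_bigcap_measurable => [|i _]; first exact: finite_finset.
    by rewrite -[X in measurable X]setTI; exact: measurable_tnth.
  by apply/seteqP; split => t h i; [move=> _; exact: h|exact: (h i)].
split=> //; rewrite /= /cons_measure /pushforward box_tcons product_measure1E// IH.
have lE : lam [set` `[0, c]] = c%:E.
  apply: (etrans (lebesgue_measure_itv `[0, c])) => /=; rewrite lte_fin.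
  case: ltP => [c1|c1]; first by rewrite oppr0 adde0.
  by congr _%:E; apply/le_anti; rewrite c1 c0.
apply: (etrans (congr1 (fun z => z * (c ^+ m)%:E)%E lE)).
by rewrite -EFinM exprS.
Qed.

Lemma ref_coord_bound m t : ref m t -> forall i, 0 <= (tnth t i : R) <= 1.
Proof.
move=> [t0 t1] i; rewrite t0 /=; apply: le_trans t1.
by rewrite (bigD1 i)//= lerDl sumr_ge0.
Qed.

Lemma lebesgue_ref_gt0 m : (0 < Lam m (ref m))%E.
Proof.
have c0 : 0 <= (m.+1%:R)^-1 :> R by rewrite invr_ge0.
have [mb be] := lebesgue_box m c0.
apply: (@lt_le_trans _ _ (Lam m (box m (m.+1%:R)^-1))).
  by rewrite be lte_fin exprn_gt0// invr_gt0.
apply: le_measure; rewrite ?inE//; first exact: measurable_ref.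
move=> t h; split => [i|]; first by have := h i; rewrite in_itv => /andP[].
rewrite (@le_trans _ _ (\sum_(i < m) (m.+1%:R)^-1))//.
  by apply: ler_sum => i _; have := h i; rewrite in_itv => /andP[].
by rewrite sumr_const card_ord -[_ *+ m]mulr_natl ler_pdivrMr// mul1r ler_nat.
Qed.

Lemma lebesgue_ref_lty m : (Lam m (ref m) < +oo)%E.
Proof.
have [mb be] := lebesgue_box m (@ler01 R).
apply: (@le_lt_trans _ _ (Lam m (box m 1))); last by rewrite be ltry.
apply: le_measure; rewrite ?inE//; first exact: measurable_ref.
by move=> t /ref_coord_bound h i; rewrite in_itv; exact: h.
Qed.

Lemma polyf_bounded_ref m (f : 'rV[R]_m -> R) : polyf f ->
  [bounded f (pt t) | t in ref m].
Proof.
move=> /polyf_bounded /(_ 1)[B hB].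
exists B; split; first exact: num_real.
move=> C BC t rt /=; apply: le_trans (ltW BC); apply: hB => i.
by rewrite mxE; have /andP[h1 h2] := ref_coord_bound rt i; rewrite ger0_norm.
Qed.

Lemma polyf_integrable_ref m (f : 'rV[R]_m -> R) : polyf f ->
  (Lam m).-integrable (ref m) (EFin \o (fun t => f (pt t))).
Proof.
move=> pf; apply: measurable_bounded_integrable.
- exact: measurable_ref.
- exact: lebesgue_ref_lty.
- by apply: measurable_funTS; exact: polyf_measurable.
- exact: polyf_bounded_ref.
Qed.

(** The simplex of dimension m+1 lies below a graph over the simplex of
    dimension m. *)
Lemma ref_tcons m x (t : m.-tuple RT) :
  ref m.+1 (tcons (x, t)) <->
  ref m t /\ (x : R) \in `[0, 1 - \sum_i (tnth t i : R)].
Proof.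
rewrite /ref_simplex /= sum_tcons in_itv /=; split=> [[h1 h2]|[[h1 h2] /andP[h3 h4]]].
  have x0 : 0 <= (x : R) := h1 ord0.
  have t0 i : 0 <= (tnth t i : R) by have := h1 (lift ord0 i); rewrite tnthS.
  rewrite x0; split; last by rewrite lerBrDr.
  by split=> //; rewrite (le_trans _ h2)// lerDr.
split; last by rewrite -lerBrDr.
by move=> i; have [j ->|->//] := unliftP ord0 i; rewrite tnthS.
Qed.

Let pt_line m (r : R) (t : m.-tuple RT) :
  pt (tcons (r : RT, t)) = r *: 'e_ord0 + pt (tcons (0 : RT, t)) :> 'rV[R]_m.+1.
Proof.
apply/rowP => i; rewrite !mxE eqxx /=.
have [j ->|->] := unliftP ord0 i; rewrite /= ?tnthS ?mulr0 ?add0r//.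
by rewrite mulr1 addr0.
Qed.

Lemma polyf_line_continuous d (g : 'rV[R]_d -> R) (x v : 'rV[R]_d) : polyf g ->
  continuous (fun r : R => g (r *: v + x) : R).
Proof.
move=> pg r; apply/differentiable_continuous/derivable1_diffP.
by have [] := @derive_line _ _ g x v r ((polyf_derivable pg v).1 _).
Qed.

Lemma integral_line_derive d (g : 'rV[R]_d -> R) (x v : 'rV[R]_d) (s : R) :
  polyf g -> 0 <= s ->
  (\int[lam]_(r in [set` `[0%R, s]%R]) ('D_v g (r *: v + x))%:E =
   (g (s *: v + x)%R - g x)%:E)%E.
Proof.
move=> pg; rewrite le_eqVlt => /predU1P[<-|s0].
  rewrite set_itv1 integral_set1 ?scale0r ?add0r ?subrr//.
have D r := @derive_line _ _ g x v r ((polyf_derivable pg v).1 _).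
have cg := @polyf_line_continuous d g x v pg.
rewrite (@continuous_FTC2 _ _ (fun r : R => g (r *: v + x) : R) 0 s) => //.
- by rewrite scale0r add0r EFinB.
- by apply: continuous_subspaceT; exact: (@polyf_line_continuous d _ x v (polyf_derive v pg)).
- split.
  + by move=> r _; have [] := D r.
  + by apply: cvg_at_right_filter; exact: cg.
  + by apply: cvg_at_left_filter; exact: cg.
- by move=> r _; rewrite derive1E; have [] := D r.
Qed.

(** Divergence theorem on the reference simplex, for a derivative in the first
    coordinate: by Fubini's theorem, integrate first along the segments parallel to
    the first axis. *)
Lemma integral_ref_derive0 m (g : 'rV[R]_m.+1 -> R) : polyf g ->
  \int[Lam m.+1]_(t in ref m.+1) 'D_('e_ord0) g (pt t) =
  \int[Lam m]_(t in ref m)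
    (g (pt (tcons ((1 - \sum_i (tnth t i : R)) : RT, t))) - g (pt (tcons (0 : RT, t)))).
Proof.
move=> pg; have pDg := polyf_derive 'e_ord0 pg.
pose Dg (t : m.+1.-tuple RT) : R := 'D_('e_ord0) g (pt t).
have mDg : measurable_fun setT Dg := polyf_measurable pDg.
pose h := Dg \_ (ref m.+1).
have mh : measurable_fun setT h.
  exact/(measurable_restrictT _ (measurable_ref m.+1))/measurable_funTS.
pose f := EFin \o h.
have mf : measurable_fun setT f by exact/measurable_EFinP.
have mt := @measurable_tcons R m.
have mrt : measurable (@tcons _ RT m @^-1` ref m.+1).
  by rewrite -[X in measurable X]setTI; apply: mt => //; exact: measurable_ref.
have intf : (lam \x Lam m)%E.-integrable setT (f \o @tcons _ RT m).
  rewrite (_ : _ \o _ = (EFin \o (Dg \o @tcons _ RT m)) \_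
      (@tcons _ RT m @^-1` ref m.+1)); last first.
    apply/funext => p; rewrite /f /h /patch /= (fun_if EFin).
    by congr (if _ then _ else _); apply/idP/idP => /set_mem ?; exact: mem_set.
  apply/(integrable_mkcond _ mrt); apply: measurable_bounded_integrable => //.
  - exact: (lebesgue_ref_lty m.+1).
  - apply: measurable_funTS.
    exact: measurableT_comp.
  - have [B [_ hB]] := polyf_bounded_ref pDg.
    by exists B; split; [exact: num_real|move=> C BC p /= rp; exact: (hB C BC _ rp)].
rewrite Rintegral_mkcond [RHS]Rintegral_mkcond /Rintegral; congr fine.
transitivity (\int[pushforward (lam \x Lam m)%E (@tcons _ RT m)]_t f t)%E.
  by apply: eq_measure_integral.
rewrite integral_pushforward// preimage_setT -integral21_prod_meas1//.
apply: eq_integral => t _.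
rewrite /fubini_G /patch.
have [rt|nrt] := boolP (t \in ref m); last first.
  apply: integral0_eq => x _ /=; rewrite /f /h /patch /= ifF//.
  by apply: contraNF nrt => /set_mem /ref_tcons[? _]; exact: mem_set.
pose s := 1 - \sum_i (tnth t i : R).
have s0 : 0 <= s by rewrite subr_ge0; have [] := set_mem rt.
transitivity (\int[lam]_(x in [set` `[0%R, s]%R])
    ('D_('e_ord0) g (x *: 'e_ord0 + pt (tcons (0%R : RT, t))))%:E)%E.
  rewrite [RHS]integral_mkcond; apply: eq_integral => x _.
  rewrite /f /h /patch /= (fun_if EFin) /Dg (pt_line x); congr (if _ then _ else _).
  apply/idP/idP => /set_mem; last first.
    by move=> xs; apply/mem_set/ref_tcons; split => //; exact: set_mem.
  by move=> /ref_tcons[_ ?]; exact: mem_set.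
by rewrite integral_line_derive// -pt_line.
Qed.

End reference_simplex.

Section zero_integral.
Context {R : realType}.
Notation RT := (measurableTypeR R).
Local Notation Lam := (lebesgue_tuple R).
Local Notation ref m := (@ref_simplex R m).

(* The homothetic copy of ratio s of the simplex, with centre [t0]. *)
Let homothety m (t0 : m.-tuple RT) (s : R) := affmap s%:M ((1 - s) *: pt t0).

Let homothetyE m (t0 t : m.-tuple RT) s i :
  (tnth (homothety t0 s t) i : R) = s * (tnth t i : R) + (1 - s) * (tnth t0 i : R).
Proof. by rewrite tnth_mktuple mul_mx_scalar !mxE. Qed.

Let homothety_ref m (t0 t : m.-tuple RT) s : 0 <= s <= 1 ->
  ref m t0 -> ref m t -> ref m (homothety t0 s t).
Proof.
move=> /andP[s0 s1] [p0 p1] [q0 q1]; split => [i|].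
  by rewrite homothetyE addr_ge0// mulr_ge0// ?subr_ge0.
under eq_bigr do rewrite homothetyE.
rewrite big_split /= -!mulr_sumr.
apply: (@le_trans _ _ (s * 1 + (1 - s) * 1)); last by lra.
by rewrite lerD// ler_wpM2l// subr_ge0.
Qed.

(** A polynomial whose square has zero integral vanishes on the whole simplex,
    including its boundary: otherwise the square is bounded below on a small
    homothetic copy of the simplex around a point where it does not vanish. *)
Lemma integral_ref_sqr_eq0 m (f : 'rV[R]_m -> R) : polyf f ->
  \int[Lam m]_(t in ref m) (f (pt t) ^+ 2) = 0 ->
  forall t, ref m t -> f (pt t) = 0.
Proof.
move=> pf f20 t0 rt0; apply: contrapT => /eqP ft0.
have ph : polyf (fun x => f x ^+ 2) by exact: polyfX.
pose c := f (pt t0) ^+ 2 / 2.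
have c0 : 0 < c by rewrite divr_gt0// exprn_even_gt0.
have [e /= e0 He] : nbhs_ball (pt t0) [set x | c < f x ^+ 2].
  apply/nbhs_ballP.
  have : (fun x => f x ^+ 2) @ pt t0 --> f (pt t0) ^+ 2.
    exact: (polyf_continuous ph).
  move=> /(@cvgr_gt _ _ _ _ _ _) /(_ c); apply.
  by rewrite /c gtr_pMr ?exprn_even_gt0// invf_lt1// ltr1n.
pose s := Num.min 1 (e / 2).
have s0 : 0 < s by rewrite lt_min ltr01 divr_gt0.
have s1 : s <= 1 by rewrite ge_min lexx.
have se : s < e.
  by rewrite gt_min; apply/orP; right; rewrite gtr_pMr// invf_lt1// ltr1n.
have cf t : ref m t -> c <= f (pt (homothety t0 s t)) ^+ 2.
  move=> rt; apply/ltW/He; split=> // i j; rewrite /ball /= (ord1 i) !mxE homothetyE.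
  have /andP[a0 a1] := ref_coord_bound rt j.
  have /andP[b0 b1] := ref_coord_bound rt0 j.
  rewrite (_ : _ - _ = s * ((tnth t0 j : R) - (tnth t j : R))); last by ring.
  rewrite normrM gtr0_norm//; apply: le_lt_trans se.
  by rewrite -[leRHS]mulr1 ler_pM2l// ler_norml; apply/andP; split; lra.
pose h (t : m.-tuple RT) : R := f (pt t) ^+ 2.
have mh : measurable_fun setT (h \_ (ref m)).
  apply/(measurable_restrictT _ (@measurable_ref R m))/measurable_funTS.
  exact: polyf_measurable ph.
have h0 t : 0 <= (h \_ (ref m)) t.
  by rewrite /patch; case: ifP => // _; exact: sqr_ge0.
have dA : \det (s%:M : 'M[R]_m) != 0 by rewrite det_scalar expf_neq0// gt_eqF.
have H0 : (\int[Lam m]_t ((h \_ (ref m)) t)%:E = 0)%E.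
  rewrite -[RHS](congr1 EFin f20) [in RHS]Rintegral_mkcond /Rintegral fineK//.
  rewrite ge0_fin_numE; last first.
    by apply: integral_ge0 => t _; rewrite lee_fin h0.
  have /integrableP[_] := (polyf_integrable_ref ph).
  rewrite (_ : (\int[_]_(_ in _) _)%E = (\int[Lam m]_t ((h \_ (ref m)) t)%:E)%E)//.
  rewrite [LHS]integral_mkcond; apply: eq_integral => t _.
  rewrite /patch /=; case: ifP => //= _.
  by rewrite ger0_norm// sqr_ge0.
have : (0 < \int[Lam m]_t ((h \_ (ref m)) t)%:E)%E; last by rewrite H0 ltxx.
rewrite (@ge0_integral_affmap _ _ s%:M ((1 - s) *: pt t0) _ dA); last 2 first.
- exact/measurable_EFinP.
- by move=> t; rewrite lee_fin h0.
rewrite mule_gt0// ?lte_fin ?normr_gt0//.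
apply: (@lt_le_trans _ _ (\int[Lam m]_(t in ref m) c%:E)%E).
  rewrite integral_cst; last exact: measurable_ref.
  by rewrite mule_gt0 ?lte_fin//; exact: lebesgue_ref_gt0.
rewrite integral_mkcond; apply: ge0_le_integral => //.
- by move=> t _; rewrite /patch; case: ifP => // _; rewrite lee_fin ltW.
- apply/(measurable_restrictT _ (@measurable_ref R m)); exact: measurable_cst.
- apply/measurable_EFinP; apply: (measurableT_comp mh); exact: measurable_affmap.
move=> t _; rewrite [leLHS]/patch; case: ifPn => [/set_mem rt|_]; last first.
  by rewrite lee_fin; exact: h0.
have rt' : affmap s%:M ((1 - s) *: pt t0) t \in ref m.
  by apply/mem_set/homothety_ref => //; rewrite ltW.
by rewrite /patch rt' lee_fin; exact: cf.
Qed.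

End zero_integral.

(** * Parametrization of a simplex by the reference simplex *)

Section simplex_parametrization.
Context {R : realType}.
Notation RT := (measurableTypeR R).
Local Notation Lam := (lebesgue_tuple R).
Local Notation ref m := (@ref_simplex R m).

(** The rows are the edges from the first vertex to the other ones. *)
Definition edge_mx n d (a : nat -> 'rV[R]_d) : 'M[R]_(n, d) :=
  \matrix_(i < n) (a i.+1 - a 0).

(** The affine map sending the origin to [a 0] and the i-th unit vector to
    [a i.+1]. *)
Definition simplex_param n d (a : nat -> 'rV[R]_d) (t : n.-tuple RT) : 'rV[R]_d :=
  pt t *m edge_mx n a + a 0.

(** Barycentric coordinates in the reference simplex; index 0 is the origin. *)
Definition bary n (t : n.-tuple RT) (i : 'I_n.+1) : R :=
  if unlift ord0 i is Some j then tnth t j else 1 - \sum_j (tnth t j : R).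

Lemma bary0 n (t : n.-tuple RT) : bary t ord0 = 1 - \sum_j (tnth t j : R).
Proof. by rewrite /bary unlift_none. Qed.

Lemma baryS n (t : n.-tuple RT) j : bary t (lift ord0 j) = tnth t j.
Proof. by rewrite /bary liftK. Qed.

Lemma sum_bary n (t : n.-tuple RT) : \sum_i bary t i = 1.
Proof.
rewrite big_ord_recl (eq_bigr (fun j => (tnth t j : R))) => [|j _].
  by rewrite bary0 subrK.
exact: baryS.
Qed.

Lemma ref_baryP n (t : n.-tuple RT) : ref n t <-> forall i, 0 <= bary t i.
Proof.
split=> [[t0 t1] i|h].
  have [j ->|->] := unliftP ord0 i; first by rewrite baryS.
  by rewrite bary0 subr_ge0.
split=> [i|]; first by rewrite -baryS.
by rewrite -subr_ge0 -bary0.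
Qed.

Lemma simplex_param_bary n d (a : nat -> 'rV[R]_d) (t : n.-tuple RT) :
  simplex_param a t = \sum_(i < n.+1) bary t i *: a i.
Proof.
rewrite big_ord_recl bary0 scalerBl scale1r /simplex_param mulmx_sum_row addrC.
rewrite -addrA; congr (_ + _); rewrite scaler_suml -sumrN -big_split /=.
apply: eq_bigr => i _; rewrite baryS rowK scalerBr addrC mxE.
by congr (_ + _); congr (_ *: a _).
Qed.

Lemma bary_inj n (t t' : n.-tuple RT) : bary t =1 bary t' -> t = t'.
Proof. by move=> h; apply/eq_from_tnth => i; rewrite -!baryS h. Qed.

(* Permutation of the vertices of the reference simplex. *)
Let permute n (s : {perm 'I_n.+1}) (t : n.-tuple RT) : n.-tuple RT :=
  tp (\row_k bary t ((s^-1)%g (lift ord0 k))).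

Let bary_permute n (s : {perm 'I_n.+1}) (t : n.-tuple RT) i :
  bary (permute s t) i = bary t ((s^-1)%g i).
Proof.
have S k : bary (permute s t) (lift ord0 k) = bary t ((s^-1)%g (lift ord0 k)).
  by rewrite baryS tnth_mktuple mxE.
have [j ->|->] := unliftP ord0 i; first exact: S.
apply: (@addIr _ (\sum_(k < n) bary (permute s t) (lift ord0 k))).
rewrite -big_ord_recl sum_bary; under eq_bigr do rewrite S.
rewrite -(big_ord_recl _ (fun k => bary t ((s^-1)%g k))).
by rewrite -(sum_bary t) (reindex_inj (@perm_inj _ (s^-1)%g)).
Qed.

Let permute_affine n (s : {perm 'I_n.+1}) : exists A b, permute s =1 @affmap R n n A b.
Proof.
pose L (i : 'I_n.+1) (j : 'I_n) : R :=
  if unlift ord0 i is Some k then (k == j)%:R else -1.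
pose c (i : 'I_n.+1) : R := (i == ord0)%:R.
have baryL (t : n.-tuple RT) i : bary t i = \sum_j (tnth t j : R) * L i j + c i.
  rewrite /L /c /bary; have [k ->|->] := unliftP ord0 i.
    rewrite eq_sym (negPf (neq_lift _ _)) addr0.
    rewrite (bigD1 k)//= eqxx mulr1 big1 ?addr0// => j jk.
    by rewrite eq_sym (negPf jk) mulr0.
  rewrite eqxx addrC -sumrN; congr (_ + _); apply: eq_bigr => j _.
  by rewrite mulrN1.
exists (\matrix_(j, k) L ((s^-1)%g (lift ord0 k)) j), (\row_k c ((s^-1)%g (lift ord0 k))).
move=> t; congr tp; apply/rowP => k; rewrite !mxE baryL; congr (_ + _).
by apply: eq_bigr => j _; rewrite !mxE.
Qed.

(* An affine bijection that preserves the simplex preserves its volume, which is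
   positive and finite. *)
Let det_preserving n (A A' : 'M[R]_n) b b' : cancel (@affmap R n n A b) (affmap A' b') ->
  affmap A b @^-1` ref n = ref n -> `|\det A| = 1.
Proof.
move=> K AK.
have AA t : pt t *m (A *m A') + (b *m A' + b') = pt t :> 'rV[R]_n.
  by rewrite -{2}(K t) affmap_comp pt_affmap.
have bb : b *m A' + b' = 0.
  by have := AA (tp 0); rewrite tpK mul0mx add0r.
have AA1 : A *m A' = 1%:M.
  apply/row_matrixP => i; rewrite rowE.
  by have := AA (tp 'e_i); rewrite tpK bb addr0 rowE mulmx1.
have dA : \det A != 0.
  apply: contra_eq_neq (congr1 determinant AA1) => dA0.
  by rewrite det_mulmx dA0 mul0r det1 eq_sym oner_eq0.
have := integral_affmap b dA (@measurable_ref R n) (measurable_cst (1 : R)).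
rewrite AK Rintegral_cst; last exact: measurable_ref.
rewrite mul1r => /esym/(canRL (mulfK _)) ->; rewrite ?divff//.
  by rewrite gt_eqF// fine_gt0// lebesgue_ref_gt0 lebesgue_ref_lty.
by rewrite gt_eqF// fine_gt0// lebesgue_ref_gt0 lebesgue_ref_lty.
Qed.

Lemma polyf_param n d (a : nat -> 'rV[R]_d) (g : 'rV[R]_d -> R) : polyf g ->
  polyf (fun x : 'rV[R]_n => g (x *m edge_mx n a + a 0)).
Proof. exact: polyf_affine. Qed.

(** The integral over the parameters does not depend on the order of the
    vertices. *)
Lemma integral_param_perm n d (s : {perm 'I_n.+1}) (a a' : nat -> 'rV[R]_d)
    (g : 'rV[R]_d -> R) : polyf g -> (forall i : 'I_n.+1, a' i = a (s i)) ->
  \int[Lam n]_(t in ref n) g (simplex_param a' t) =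
  \int[Lam n]_(t in ref n) g (simplex_param a t).
Proof.
move=> pg aa'.
have [A [b PE]] := permute_affine s; have [A' [b' PE']] := permute_affine (s^-1)%g.
have K : cancel (@affmap R n n A b) (affmap A' b').
  move=> t; rewrite -PE -PE'; apply: bary_inj => i.
  by rewrite !bary_permute invgK permK.
have AK : affmap A b @^-1` ref n = ref n.
  apply/seteqP; split => t /=; rewrite -PE => /ref_baryP h; apply/ref_baryP => i.
    by have := h (s i); rewrite bary_permute permK.
  by rewrite bary_permute.
have d1 := det_preserving K AK.
have dA : \det A != 0 by rewrite -normr_eq0 d1 oner_eq0.
rewrite [RHS](integral_affmap b dA (@measurable_ref R n)); last first.
  exact: (polyf_measurable (polyf_param n a pg)).
rewrite d1 mul1r AK; apply: eq_Rintegral => t _; congr g.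
rewrite -PE !simplex_param_bary [RHS](reindex_inj (@perm_inj _ s)) /=.
by apply: eq_bigr => i _; rewrite bary_permute permK aa'.
Qed.

(** The same for two listings of the same vertices. *)
Lemma integral_param_perm_eq n d (T : eqType) (s s' : seq T) (pos : T -> 'rV[R]_d)
    (g : 'rV[R]_d -> R) : polyf g -> size s = n.+1 -> perm_eq s s' ->
  \int[Lam n]_(t in ref n) g (simplex_param (nth 0 [seq pos i | i <- s]) t) =
  \int[Lam n]_(t in ref n) g (simplex_param (nth 0 [seq pos i | i <- s']) t).
Proof.
move=> pg /eqP ss ps.
have ss' : size s' == n.+1 by rewrite -(perm_size ps).
have [f fE] := tuple_permP (ps : perm_eq (Tuple ss) (Tuple ss')).
apply: (@integral_param_perm _ _ f) => // i.
pose x0 := tnth (Tuple ss') ord0.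
rewrite !(nth_map x0) ?(eqP ss) ?(eqP ss') ?ltn_ord//.
rewrite [s in LHS](_ : s = Tuple ss)// fE.
rewrite -[X in nth x0 X i]/(val [tuple tnth (Tuple ss') (f i) | i < n.+1]).
by rewrite -tnth_nth tnth_mktuple (tnth_nth x0).
Qed.

Lemma vol_integral_param d (a : nat -> 'rV[R]_d) (D : set 'rV[R]_d) (g : 'rV[R]_d -> R) :
  \det (edge_mx d a) != 0 -> polyf g ->
  (forall x, D x <-> exists2 t, ref d t & x = simplex_param a t) ->
  measurable (@pt R d @^-1` D) /\
  vol_integral D g = `|\det (edge_mx d a)| *
                     \int[Lam d]_(t in ref d) g (simplex_param a t).
Proof.
move=> dE pg DE; set E := edge_mx d a.
have uE : E \in unitmx by rewrite unitmxE unitfE.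
pose inv := affmap (invmx E) (- a 0%N *m invmx E) : d.-tuple RT -> d.-tuple RT.
have K1 : cancel (@affmap R d d E (a 0)) inv.
  move=> t; apply: (can_inj (@ptK R d)); rewrite !pt_affmap.
  by rewrite -mulmxDl addrK mulmxK.
have K2 : cancel inv (@affmap R d d E (a 0)).
  move=> t; apply: (can_inj (@ptK R d)); rewrite !pt_affmap.
  by rewrite -mulmxDl mulmxKV// subrK.
have DI : @pt R d @^-1` D = inv @^-1` ref d.
  apply/seteqP; split => t /=.
    move=> /DE[u ru tE]; have -> : t = affmap E (a 0) u.
      by apply: (can_inj (@ptK R d)); rewrite pt_affmap tE.
    by rewrite K1.
  by move=> rt; apply/DE; exists (inv t) => //; rewrite -[LHS](congr1 (@pt R d) (K2 t)) pt_affmap.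
have mD : measurable (@pt R d @^-1` D).
  by rewrite DI; apply: measurable_affmap_preimage; exact: measurable_ref.
split=> //; rewrite /vol_integral (integral_affmap (a 0) dE mD); last exact: polyf_measurable.
congr (_ * _); rewrite DI (_ : _ @^-1` _ = ref d); last first.
  by apply/seteqP; split => t /=; rewrite K1.
by apply: eq_Rintegral => t _; rewrite pt_affmap.
Qed.

(** Derivative along the edge from [a 0] to [a 1]: only the faces opposite to these
    two vertices contribute. *)
Lemma integral_param_derive m d (a : nat -> 'rV[R]_d) (g : 'rV[R]_d -> R) : polyf g ->
  \int[Lam m.+1]_(t in ref m.+1) 'D_(a 1 - a 0) g (simplex_param a t) =
  \int[Lam m]_(t in ref m) g (simplex_param (fun i => a i.+1) t) -
  \int[Lam m]_(t in ref m) g (simplex_param (fun i => if i is 0 then a 0 else a i.+1) t).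
Proof.
move=> pg; have pG := polyf_param m.+1 a pg.
transitivity (\int[Lam m.+1]_(t in ref m.+1)
  'D_('e_ord0) (fun x : 'rV[R]_m.+1 => g (x *m edge_mx m.+1 a + a 0)) (pt t)).
  apply: eq_Rintegral => t _; rewrite derive_affine; congr ('D__ g _).
  by rewrite -rowE rowK.
rewrite integral_ref_derive0// -RintegralB; last 3 first.
- exact: measurable_ref.
- exact: (polyf_integrable_ref (polyf_param m (fun i => a i.+1) pg)).
- exact: (polyf_integrable_ref (polyf_param m (fun i => if i is 0 then a 0 else a i.+1) pg)).
apply: eq_Rintegral => t _; congr (g _ - g _);
  rewrite -[LHS]/(simplex_param a _) !simplex_param_bary.
- rewrite big_ord_recl bary0 (_ : 1 - _ = 0) ?scale0r ?add0r; last first.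
    by rewrite sum_tcons subrK subrr.
  apply: eq_bigr => i _; rewrite baryS; congr (_ *: a _).
  by have [j ->|->] := unliftP ord0 i; rewrite ?tnthS ?baryS ?bary0.
- rewrite big_ord_recl bary0 sum_tcons add0r [RHS]big_ord_recl bary0; congr (_ + _).
  rewrite big_ord_recl baryS scale0r add0r.
  by apply: eq_bigr => i _; rewrite !baryS tnthS.
Qed.

End simplex_parametrization.

Section dot_product.
Context {R : realType} {d : nat}.
Implicit Types a b c : 'rV[R]_d.

Lemma dotpE a b : dotp a b = (a *m b^T) ord0 ord0.
Proof. by rewrite mxE; apply: eq_bigr => i _; rewrite mxE. Qed.

Lemma dotpC a b : dotp a b = dotp b a.
Proof. by apply: eq_bigr => i _; rewrite mulrC. Qed.

Lemma dotpDr a b c : dotp a (b + c) = dotp a b + dotp a c.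
Proof. by rewrite -big_split; apply: eq_bigr => i _; rewrite mxE mulrDr. Qed.

Lemma dotpZr k a b : dotp a (k *: b) = k * dotp a b.
Proof. by rewrite mulr_sumr; apply: eq_bigr => i _; rewrite mxE mulrCA. Qed.

Lemma dotpNr a b : dotp a (- b) = - dotp a b.
Proof. by rewrite -scaleN1r dotpZr mulN1r. Qed.

Lemma dotpBr a b c : dotp a (b - c) = dotp a b - dotp a c.
Proof. by rewrite dotpDr dotpNr. Qed.

Lemma dotpZl k a b : dotp (k *: a) b = k * dotp a b.
Proof. by rewrite dotpC dotpZr dotpC. Qed.

Lemma dotp_gt0 a : a != 0 -> 0 < dotp a a.
Proof.
move=> a0; rewrite lt_neqAle sumr_ge0 ?andbT => [|i _]; last by rewrite -expr2 sqr_ge0.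
apply: contraNneq a0 => /esym/eqP; rewrite psumr_eq0 => [/allP h|i _]; last first.
  by rewrite -expr2 sqr_ge0.
apply/eqP/rowP => i; rewrite mxE; apply/eqP.
by have := h i (mem_index_enum _); rewrite -expr2 sqrf_eq0.
Qed.

End dot_product.

Section hull_parametrization.
Context {R : realType} {d : nat} (M : mesh R d).
Notation vset := {set 'I_(nvertex M)}.
Notation RT := (measurableTypeR R).
Local Notation ref m := (@ref_simplex R m).
Implicit Types (S : vset) (s : seq 'I_(nvertex M)).

(** The positions of the vertices listed by [s], followed by zeros. *)
Definition points s : nat -> 'rV[R]_d := nth 0 [seq vertex i | i <- s].

Lemma points_nth x0 s i : (i < size s)%N -> points s i = vertex (nth x0 s i).
Proof. by move=> si; rewrite /points (nth_map x0). Qed.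

Lemma big_listing (V : nmodType) S s n x0 (F : 'I_(nvertex M) -> V) :
  perm_eq s (enum S) -> size s = n ->
  \sum_(i in S) F i = \sum_(j < n) F (nth x0 s j).
Proof.
move=> ps <-; rewrite -big_enum /= -(perm_big _ ps) /=.
by rewrite (big_nth x0) big_mkord.
Qed.

Lemma hull_param S s n x : perm_eq s (enum S) -> size s = n.+1 ->
  hull S x <-> exists2 t : n.-tuple RT, ref n t & x = simplex_param (points s) t.
Proof.
move=> ps ss.
have us : uniq s by rewrite (perm_uniq ps) enum_uniq.
have x0 : 'I_(nvertex M) by case: (s) ss => [//|y s' _]; exact: y.
split=> [[w [w0 w1 ->]]|[t /ref_baryP bt ->]].
  pose t : n.-tuple RT := tp (\row_k w (nth x0 s k.+1)).
  have wS : \sum_(i < n.+1) w (nth x0 s i) = 1.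
    by rewrite -w1 (big_listing x0 _ ps ss).
  have bw (i : 'I_n.+1) : bary t i = w (nth x0 s i).
    have S' k : bary t (lift ord0 k) = w (nth x0 s (lift ord0 k)).
      by rewrite baryS tnth_mktuple mxE.
    have [j ->|->] := unliftP ord0 i; first exact: S'.
    apply: (@addIr _ (\sum_(k < n) bary t (lift ord0 k))).
    rewrite -big_ord_recl sum_bary; under eq_bigr do rewrite S'.
    by rewrite -wS big_ord_recl.
  exists t; first by apply/ref_baryP => i; rewrite bw.
  rewrite simplex_param_bary (big_listing x0 _ ps ss); apply: eq_bigr => i _.
  by rewrite bw (points_nth x0)// ss.
pose w i := if (insub (index i s) : option 'I_n.+1) is Some j then bary t j else 0.
have wE (i : 'I_n.+1) : w (nth x0 s i) = bary t i.
  rewrite /w index_uniq// ?ss//; case: insubP => [j _ ji|]; last by rewrite ltn_ord.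
  by congr bary; apply/val_inj.
exists w; split.
- by move=> i; rewrite /w; case: insubP.
- by rewrite (big_listing x0 _ ps ss) -(sum_bary t); apply: eq_bigr => i _.
- rewrite simplex_param_bary (big_listing x0 _ ps ss); apply: eq_bigr => i _.
  by rewrite wE (points_nth x0)// ss.
Qed.

(** The edges from the first vertex of an affinely independent set are linearly
    independent. *)
Lemma edge_mx_free S s n : perm_eq s (enum S) -> size s = n.+1 ->
  affinely_independent S -> forall y : 'rV[R]_n, y *m edge_mx n (points s) = 0 -> y = 0.
Proof.
move=> ps ss aS y y0.
have us : uniq s by rewrite (perm_uniq ps) enum_uniq.
have x0 : 'I_(nvertex M) by case: (s) ss => [//|z s' _]; exact: z.
pose c (j : 'I_n.+1) : R := if unlift ord0 j is Some k then y ord0 k else - \sum_k y ord0 k.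
pose w i := if (insub (index i s) : option 'I_n.+1) is Some j then c j else 0.
have wE (i : 'I_n.+1) : w (nth x0 s i) = c i.
  rewrite /w index_uniq// ?ss//; case: insubP => [j _ ji|]; last by rewrite ltn_ord.
  by congr c; apply/val_inj.
have cS k : c (lift ord0 k) = y ord0 k by rewrite /c liftK.
have c0 : c ord0 = - \sum_k y ord0 k by rewrite /c unlift_none.
have sc : \sum_(i in S) w i = 0.
  rewrite (big_listing x0 _ ps ss) (eq_bigr c) // big_ord_recl c0.
  by rewrite (eq_bigr _ (fun k _ => cS k)) addNr.
have sv : \sum_(i in S) w i *: vertex i = 0.
  rewrite (big_listing x0 _ ps ss) -[RHS]y0 mulmx_sum_row big_ord_recl wE c0.
  rewrite scaleNr scaler_suml -sumrN -big_split /=; apply: eq_bigr => k _.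
  have -> : w (nth x0 s (bump 0 k)) = y ord0 k := etrans (wE (lift ord0 k)) (cS k).
  rewrite rowK scalerBr addrC; congr (_ *: _ - _ *: _).
    by rewrite (points_nth x0)// ss ltnS ltn_ord.
  by rewrite (points_nth x0)// ss.
apply/rowP => k; rewrite mxE -cS -wE; apply: (aS w sc sv).
by rewrite -mem_enum -(perm_mem ps) mem_nth// ss.
Qed.

End hull_parametrization.

(** * Volumes of cells, areas and normals of facets *)

Section cell.
Context {R : realType} {m : nat} (M : mesh R m.+1).
Notation vset := {set 'I_(nvertex M)}.
Notation RT := (measurableTypeR R).
Local Notation Lam := (lebesgue_tuple R).
Local Notation ref m := (@ref_simplex R m).
Variable K : vset.
Hypotheses (cardK : #|K| = m.+2) (freeK : affinely_independent K).

Let size_listing (s : seq 'I_(nvertex M)) : perm_eq s (enum K) -> size s = m.+2.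
Proof. by move=> /perm_size ->; rewrite -cardE. Qed.

Lemma det_listing_neq0 (s : seq 'I_(nvertex M)) : perm_eq s (enum K) ->
  \det (edge_mx m.+1 (points s)) != 0.
Proof.
move=> ps; apply/negP => /det0P[y y0 yE].
by move/eqP: y0; apply; exact: (edge_mx_free ps (size_listing ps)).
Qed.

Lemma cell_integral_param (s : seq 'I_(nvertex M)) (g : 'rV[R]_m.+1 -> R) :
  perm_eq s (enum K) -> polyf g ->
  measurable (@pt R m.+1 @^-1` hull K) /\
  vol_integral (hull K) g = `|\det (edge_mx m.+1 (points s))| *
    \int[Lam m.+1]_(t in ref m.+1) g (simplex_param (points s) t).
Proof.
move=> ps pg; apply: vol_integral_param => //; first exact: det_listing_neq0.
by move=> x; apply: hull_param => //; exact: size_listing.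
Qed.

(** The Jacobian of the parametrization of [K]; by [det_listing] it does not depend
    on the order of the vertices. *)
Definition cell_jac : R := `|\det (edge_mx m.+1 (points (enum K)))|.

Lemma cell_jac_gt0 : 0 < cell_jac.
Proof. by rewrite normr_gt0; exact: det_listing_neq0. Qed.

(** Both determinants are the ratio of the volumes of [K] and of the reference
    simplex. *)
Lemma det_listing (s : seq 'I_(nvertex M)) : perm_eq s (enum K) ->
  `|\det (edge_mx m.+1 (points s))| = cell_jac.
Proof.
move=> ps; have p1 : polyf (fun _ : 'rV[R]_m.+1 => 1 : R) by exact: polyf_cst.
have [_ e1] := cell_integral_param ps p1.
have [_] := cell_integral_param (perm_refl (enum K)) p1.
rewrite e1 Rintegral_cst; last exact: measurable_ref.
rewrite mul1r => /mulIf; apply.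
by rewrite gt_eqF// fine_gt0// lebesgue_ref_gt0 lebesgue_ref_lty.
Qed.

Lemma facet_paramE (F : vset) (t : m.-tuple RT) :
  facet_param F t = simplex_param (facet_point F) t.
Proof.
rewrite /facet_param /simplex_param addrC mulmx_sum_row; congr (_ + _).
by apply: eq_bigr => i _; rewrite rowK mxE.
Qed.

Lemma facet_integral_setT (F : vset) (g : 'rV[R]_m.+1 -> R) :
  facet_integral F setT g = Num.sqrt (\det (facet_gram F)) *
    \int[Lam m]_(t in ref m) g (simplex_param (facet_point F) t).
Proof.
rewrite /facet_integral (_ : facet_dom F setT = ref m); last first.
  by rewrite /facet_dom preimage_setT setIT.
congr (_ * _); apply: eq_Rintegral => t _; congr g; exact: facet_paramE.
Qed.

Lemma facet_gramE (F : vset) :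
  facet_gram F = edge_mx m (facet_point F) *m (edge_mx m (facet_point F))^T.
Proof.
apply/matrixP => i j; rewrite !mxE; apply: eq_bigr => k _.
by rewrite !mxE.
Qed.

Variable v : 'I_(nvertex M).
Hypothesis vK : v \in K.
Let F := K :\ v.
Let p0 := facet_point F 0.
Let E : 'M[R]_(m, m.+1) := edge_mx m (facet_point F).
Let b : 'rV[R]_m.+1 := vertex v - p0.
Let B : 'M[R]_(1 + m, m.+1) := col_mx b E.

Let cardF : #|F| = m.+1.
Proof. by have := cardsD1 v K; rewrite vK cardK add1n => -[]. Qed.

Let enumF : exists w r, enum F = w :: r.
Proof.
have : size (enum F) = m.+1 by rewrite -cardE.
by case: (enum F) => // w r _; exists w, r.
Qed.

Lemma perm_facet : perm_eq (v :: enum F) (enum K).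
Proof.
apply: uniq_perm; rewrite /= ?enum_uniq ?mem_enum ?in_setD1 ?eqxx//.
move=> i; rewrite inE !mem_enum in_setD1.
by case: eqVneq => // ->.
Qed.

Let BE : (B : 'M[R]_m.+1) = edge_mx m.+1
  (points (head v (enum F) :: v :: behead (enum F))).
Proof.
have [w [r eF]] := enumF.
apply/matrixP => i l; rewrite [RHS]mxE; have [j ->|->] := unliftP ord0 i.
  rewrite (_ : lift ord0 j = rshift 1 j :> 'I_(1 + m)); last exact/val_inj.
  by rewrite [LHS]col_mxEd mxE /facet_point eF.
rewrite (_ : ord0 = lshift m ord0 :> 'I_(1 + m)); last exact/val_inj.
by rewrite [LHS]col_mxEu /b /p0 /facet_point eF.
Qed.

Let perm_facet' : perm_eq (head v (enum F) :: v :: behead (enum F)) (enum K).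
Proof.
have [w [r eF]] := enumF; apply: perm_trans perm_facet; rewrite eF /=.
exact: permEl (perm_catCA [:: w] [:: v] r).
Qed.

Let detB : \det (B : 'M[R]_m.+1) != 0.
Proof. by rewrite BE det_listing_neq0. Qed.

Let jacB : `|\det (B : 'M[R]_m.+1)| = cell_jac.
Proof. by rewrite BE det_listing. Qed.

Let facet_pointP j : j \in F ->
  vertex j = p0 \/ exists i, vertex j - p0 = row i E.
Proof.
move=> jF; have [w [r eF]] := enumF.
have := jF; rewrite -mem_enum => jE.
have := nth_index v jE; have := index_mem j (enum F); rewrite jE.
have sF : size (enum F) = m.+1 by rewrite -cardE.
rewrite sF.
case: (index j (enum F)) => [|k] km nj; [left|right].
  by rewrite /p0 /facet_point (nth_map v) ?sF// nj.
exists (Ordinal (km : (k < m)%N)); rewrite rowK /=; congr (_ - _).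
by rewrite /facet_point (nth_map v) ?sF// nj.
Qed.

Let facet_orthogonal (n : 'rV[R]_m.+1) : E *m n^T = 0 ->
  forall j, j \in F -> dotp n (vertex j - p0) = 0.
Proof.
move=> En j /facet_pointP[->|[i ->]]; first by rewrite subrr dotpE trmx0 mulmx0 mxE.
by rewrite dotpC dotpE -row_mul En row0 mxE.
Qed.

(** The unit normal exists: solve [B x = -e_0], where the first row [b] of the
    invertible matrix [B] goes from the facet to the opposite vertex [v] and the
    other rows are edges of the facet, and normalize [x]. *)
Lemma normal_outward : is_outward_normal K F (normal K F).
Proof.
rewrite /normal; apply: (@xgetPex _ 0 [set n | is_outward_normal K F n]).
have uB : (B : 'M[R]_m.+1) \in unitmx by rewrite unitmxE unitfE.
pose x : 'rV[R]_m.+1 := - (invmx (B : 'M[R]_m.+1) *m (col_mx 1%:M 0 : 'cV[R]_(1 + m)))^T.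
have Bx : B *m x^T = col_mx (-1)%:M 0.
  rewrite linearN /= trmxK mulmxN mulKVmx// opp_col_mx oppr0.
  by rewrite raddfN.
have [bx Ex] : dotp b x = -1 /\ E *m x^T = 0.
  move: Bx; rewrite mul_col_mx => /eq_col_mx[h ->]; split=> //.
  by rewrite dotpE h mxE mulr1n.
have x0 : x != 0.
  by apply: contra_eq_neq bx => ->; rewrite dotpE trmx0 mulmx0 mxE eq_sym oppr_eq0 oner_eq0.
pose l := (Num.sqrt (dotp x x))^-1.
have l0 : 0 < l by rewrite invr_gt0 sqrtr_gt0 dotp_gt0.
have O := facet_orthogonal Ex.
exists (l *: x) => /=; split.
- rewrite dotpZl dotpZr mulrA -expr2 /l exprVn sqr_sqrtr ?mulVf//.
    by rewrite gt_eqF// dotp_gt0.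
  by rewrite ltW// dotp_gt0.
- move=> i j iF jF; rewrite dotpZl (_ : _ - _ = (vertex i - p0) - (vertex j - p0)).
    by rewrite dotpBr !O// subrr mulr0.
  by rewrite opprB addrA subrK.
- move=> i j /setDP[iK]; rewrite in_setD1 iK andbT negbK => /eqP-> jF.
  rewrite dotpZl pmulr_rlt0// (_ : _ - _ = b - (vertex j - p0)).
    by rewrite dotpBr O// subr0 dotpC bx ltrN10.
  by rewrite /b opprB addrA subrK.
Qed.

(** Height times area: the parallelepiped spanned by the edges of [K] has as base
    the one spanned by the edges of the facet opposite to [v], of area
    [sqrt (det Gram)], and the height of [v] above this facet. *)
Lemma cell_jac_normal w : w \in F ->
  cell_jac = Num.sqrt (\det (facet_gram F)) * dotp (normal K F) (vertex w - vertex v).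
Proof.
move=> wF; set n := normal K F; have [n1 nF nv] := normal_outward.
rewrite -/n in n1 nF nv.
have [u [r eF]] := enumF.
have uF : u \in F by rewrite -mem_enum eF mem_head.
have p0E : p0 = vertex u by rewrite /p0 /facet_point eF.
have En : E *m n^T = 0.
  apply/row_matrixP => i; rewrite row_mul row0; apply/rowP => j.
  rewrite (ord1 j) -dotpE mxE dotpC rowK -/p0 p0E /facet_point.
  rewrite (nth_map v) ?nF// -?cardE ?cardF ?ltnS ?ltn_ord//.
  by rewrite -mem_enum mem_nth// -cardE cardF ltnS ltn_ord.
have Hb : dotp n b = - dotp n (vertex w - vertex v).
  rewrite /b p0E -dotpNr opprB.
  rewrite (_ : vertex v - vertex u =
    (vertex v - vertex w) + (vertex w - vertex u)).
    by rewrite dotpDr (nF w u)// addr0.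
  by rewrite addrA subrK.
(* [N] is [B] with its first row replaced by the unit normal: [N *m N^T] is block
   diagonal with blocks 1 and the Gram matrix, and [B *m N^T] is block triangular
   with diagonal blocks [dotp n b] and the Gram matrix. *)
pose N : 'M[R]_(1 + m) := col_mx n E.
have nn : n *m n^T = 1%:M :> 'M[R]_1 by rewrite [LHS]mx11_scalar -dotpE n1.
have nE : n *m E^T = 0 by rewrite -[LHS]trmxK trmx_mul trmxK En trmx0.
have NN : \det N ^+ 2 = \det (facet_gram F).
  rewrite expr2 -{2}det_tr -det_mulmx tr_col_mx mul_col_row nn En nE.
  by rewrite det_ublock det1 mul1r facet_gramE.
have BN : \det (B : 'M[R]_(1 + m)) * \det N = dotp n b * \det (facet_gram F).
  rewrite -[X in _ * X]det_tr -det_mulmx tr_col_mx mul_col_row En.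
  by rewrite det_ublock det_mx11 -dotpE dotpC facet_gramE.
have N0 : \det N != 0.
  apply/negP => /det0P[y y0]; rewrite -[y]hsubmxK mul_row_col => yN.
  have l0 : lsubmx y = 0.
    have := congr1 (fun A => A *m n^T) yN.
    by rewrite mulmxDl -!mulmxA nn En mulmx0 addr0 mulmx1 mul0mx.
  move: yN; rewrite l0 mul0mx add0r => yE.
  case/negP: detB; apply/det0P; exists y => //.
  rewrite -[y]hsubmxK l0; apply: (etrans (mul_row_col 0 (rsubmx y) b E)).
  by rewrite yE mul0mx addr0.
have H0 : 0 < dotp n (vertex w - vertex v).
  rewrite -opprB dotpNr oppr_gt0; apply: nv => //.
  by rewrite !inE eqxx vK.
rewrite -jacB -NN sqrtr_sqr.
have -> : \det (B : 'M[R]_m.+1) = - (dotp n (vertex w - vertex v) * \det N).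
  apply: (mulIf N0); rewrite [LHS]BN Hb -NN expr2.
  by ring.
by rewrite normrN normrM gtr0_norm// mulrC.
Qed.

End cell.

(** * Integration by parts on a simplex *)

Section reference_linearity.
Context {R : realType} {n : nat}.
Local Notation Lam := (lebesgue_tuple R).
Local Notation ref m := (@ref_simplex R m).

(** The integral over the reference simplex of a function on R^n. *)
Definition ref_integral (f : 'rV[R]_n -> R) : R := \int[Lam n]_(t in ref n) f (pt t).

Lemma ref_integralD f g : polyf f -> polyf g ->
  ref_integral (fun x => f x + g x) = ref_integral f + ref_integral g.
Proof.
by move=> pf pg; apply: RintegralD;
  [exact: measurable_ref|exact: polyf_integrable_ref..].
Qed.

Lemma ref_integralZ c f : polyf f ->
  ref_integral (fun x => c * f x) = c * ref_integral f.
Proof.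
by move=> pf; apply: RintegralZl;
  [exact: measurable_ref|exact: polyf_integrable_ref].
Qed.

Lemma ref_integral_sum (I : Type) (s : seq I) (f : I -> 'rV[R]_n -> R) :
  (forall i, polyf (f i)) ->
  ref_integral (fun x => \sum_(i <- s) f i x) = \sum_(i <- s) ref_integral (f i).
Proof.
move=> pf; elim: s => [|i s IH].
  rewrite big_nil -[RHS](mul0r (ref_integral (fun=> 0))) -ref_integralZ.
    by congr ref_integral; apply/funext => x; rewrite big_nil mul0r.
  exact: polyf_cst.
rewrite big_cons -IH -ref_integralD//; last exact: polyf_sum.
by congr ref_integral; apply/funext => x; rewrite big_cons.
Qed.

End reference_linearity.

Section green.
Context {R : realType} {m : nat} (M : mesh R m.+1).
Notation vset := {set 'I_(nvertex M)}.
Local Notation Lam := (lebesgue_tuple R).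
Local Notation ref m := (@ref_simplex R m).
Variable K : vset.
Hypotheses (cardK : #|K| = m.+2) (freeK : affinely_independent K).
Implicit Types (f g q : 'rV[R]_m.+1 -> R) (c : 'rV[R]_m.+1).

(* Integrals over cells and facets as integrals over reference simplices *)
Let on_cell g : 'rV[R]_m.+1 -> R :=
  fun x => g (x *m edge_mx m.+1 (points (enum K)) + points (enum K) 0).

Let on_facet (F : vset) g : 'rV[R]_m -> R :=
  fun x => g (x *m edge_mx m (facet_point F) + facet_point F 0).

Let polyf_cell g : polyf g -> polyf (on_cell g).
Proof. exact: polyf_affine. Qed.

Let polyf_facet F g : polyf g -> polyf (on_facet F g).
Proof. exact: polyf_affine. Qed.

Lemma cell_integralE g : polyf g ->
  vol_integral (hull K) g = cell_jac K * ref_integral (on_cell g).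
Proof. by move=> pg; have [_ ->] := cell_integral_param cardK freeK (perm_refl _) pg. Qed.

Lemma facet_integralE (F : vset) g : facet_integral F setT g =
  Num.sqrt (\det (facet_gram F)) * ref_integral (on_facet F g).
Proof. exact: facet_integral_setT. Qed.

Lemma cell_integral_sum (I : Type) (s : seq I) (f : I -> 'rV[R]_m.+1 -> R) :
  (forall i, polyf (f i)) ->
  vol_integral (hull K) (fun x => \sum_(i <- s) f i x) =
  \sum_(i <- s) vol_integral (hull K) (f i).
Proof.
move=> pf; rewrite cell_integralE; last exact: polyf_sum.
rewrite [X in _ * X](ref_integral_sum s (fun i => polyf_cell (pf i))) mulr_sumr.
by apply: eq_bigr => i _; rewrite cell_integralE.
Qed.

Lemma cell_integralD f g : polyf f -> polyf g ->
  vol_integral (hull K) (fun x => f x + g x) =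
  vol_integral (hull K) f + vol_integral (hull K) g.
Proof.
move=> pf pg; rewrite !cell_integralE//; last exact: polyfD.
by rewrite [X in _ * X](ref_integralD (polyf_cell pf) (polyf_cell pg)) mulrDr.
Qed.

Lemma cell_integralZ (k : R) f : polyf f ->
  vol_integral (hull K) (fun x => k * f x) = k * vol_integral (hull K) f.
Proof.
move=> pf; rewrite !cell_integralE//; last first.
  by apply: polyfM => //; exact: polyf_cst.
by rewrite [X in _ * X](ref_integralZ k (polyf_cell pf)) mulrCA.
Qed.

Lemma facet_integral_sum (F : vset) (I : Type) (s : seq I) (f : I -> 'rV[R]_m.+1 -> R) :
  (forall i, polyf (f i)) ->
  facet_integral F setT (fun x => \sum_(i <- s) f i x) =
  \sum_(i <- s) facet_integral F setT (f i).
Proof.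
move=> pf; rewrite facet_integralE.
rewrite [X in _ * X](ref_integral_sum s (fun i => polyf_facet F (pf i))) mulr_sumr.
by apply: eq_bigr => i _; rewrite facet_integralE.
Qed.

Lemma facet_integralZ (F : vset) (k : R) f : polyf f ->
  facet_integral F setT (fun x => k * f x) = k * facet_integral F setT f.
Proof.
move=> pf; rewrite !facet_integralE//.
by rewrite [X in _ * X](ref_integralZ k (polyf_facet F pf)) mulrCA.
Qed.

(* The fundamental theorem of calculus along the edge from [v] to [w]. *)
Lemma cell_integral_derive_edge v w g : v \in K -> w \in K -> v != w -> polyf g ->
  vol_integral (hull K) ('D_(vertex w - vertex v) g) =
  cell_jac K * (ref_integral (on_facet (K :\ v) g) - ref_integral (on_facet (K :\ w) g)).
Proof.
move=> vK wK vw pg; pose r := enum (K :\ v :\ w).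
have wKv : w \in K :\ v by rewrite in_setD1 eq_sym vw.
have vKw : v \in K :\ w by rewrite in_setD1 vw.
have pw : perm_eq (w :: r) (enum (K :\ v)) by exact: perm_facet.
have pv : perm_eq (v :: r) (enum (K :\ w)).
  rewrite /r (_ : K :\ v :\ w = K :\ w :\ v); first exact: perm_facet.
  by apply/setP => i; rewrite !in_setD1 andbCA.
have ps : perm_eq (v :: w :: r) (enum K).
  by apply: perm_trans (perm_facet vK); rewrite perm_cons.
have sr : size (w :: r) = m.+1.
  rewrite (perm_size pw) -cardE.
  by have := cardsD1 v K; rewrite vK cardK add1n => -[].
have [_ ->] := cell_integral_param cardK freeK ps (polyf_derive (vertex w - vertex v) pg).
rewrite (det_listing cardK freeK ps); congr (_ * _).
rewrite (integral_param_derive m (points (v :: w :: r)) pg).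
congr (_ - _).
  have := integral_param_perm_eq (@vertex _ _ M) pg sr pw; apply: etrans.
  by apply: eq_Rintegral => t _; congr g.
have := integral_param_perm_eq (@vertex _ _ M) pg (sr : size (v :: r) = m.+1) pv.
apply: etrans; apply: eq_Rintegral => t _; congr g.
Qed.

(** Gauss's theorem for the vector field [g c], [c] constant. Both sides are linear
    in [c], and by the previous lemma they agree on the edges of [K], which span
    the space. *)
Lemma cell_integral_derive c g : polyf g ->
  vol_integral (hull K) ('D_c g) =
  \sum_(v in K) facet_integral (K :\ v) setT (fun x => dotp c (normal K (K :\ v)) * g x).
Proof.
move=> pg.
pose L : 'rV[R]_m.+1 := \row_j vol_integral (hull K) ('D_('e_j) g).
pose N : 'rV[R]_m.+1 := \sum_(v in K) facet_integral (K :\ v) setT g *: normal K (K :\ v).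
have LE e : vol_integral (hull K) ('D_e g) = dotp e L.
  rewrite (_ : 'D_e g = fun x => \sum_j e ord0 j * 'D_('e_j) g x); last first.
    by apply/funext => x; exact: polyf_derivative_sum.
  rewrite cell_integral_sum => [|j]; last first.
    by apply: polyfM; [exact: polyf_cst|exact: polyf_derive].
  apply: eq_bigr => j _; rewrite cell_integralZ ?mxE//; exact: polyf_derive.
have NE e : \sum_(v in K) facet_integral (K :\ v) setT
    (fun x => dotp e (normal K (K :\ v)) * g x) = dotp e N.
  rewrite (big_morph (dotp e) (dotpDr e) (_ : dotp e 0 = 0)); last first.
    by rewrite dotpE trmx0 mulmx0 mxE.
  by apply: eq_bigr => v _; rewrite facet_integralZ// dotpZr mulrC.
rewrite LE NE; congr dotp.
have edge v w : v \in K -> w \in K -> dotp (vertex w - vertex v) L = dotp (vertex w - vertex v) N.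
  move=> vK wK; have [->|vw] := eqVneq v w.
    by rewrite subrr !dotpE !mul0mx.
  rewrite -LE -NE cell_integral_derive_edge//.
  have wKv : w \in K :\ v by rewrite in_setD1 eq_sym vw.
  have vKw : v \in K :\ w by rewrite in_setD1 vw.
  have wKv' : (w \in K) && (w != v) by rewrite wK eq_sym vw.
  rewrite (bigD1 v vK) (bigD1 w wKv') /=.
  rewrite [X in _ + (_ + X)]big1; last first.
    move=> u /andP[/andP[uK uv] uw]; have [_ O _] := normal_outward cardK freeK uK.
    have vu : v \in K :\ u by rewrite in_setD1 eq_sym uv vK.
    have wu : w \in K :\ u by rewrite in_setD1 eq_sym uw wK.
    by rewrite facet_integralZ// dotpC (O _ _ wu vu) mul0r.
  apply: etrans (congr1 (fun z : R => _ + z) (esym (addr0 _))).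
  rewrite !facet_integralZ// !facet_integralE mulrBr; congr (_ + _).
    rewrite mulrA (cell_jac_normal cardK freeK vK wKv) [dotp _ (normal _ _)]dotpC.
    by rewrite [dotp _ _ * _]mulrC.
  rewrite mulrA (cell_jac_normal cardK freeK wK vKw) -mulNr; congr (_ * _).
  by rewrite [dotp _ (normal _ _)]dotpC -(opprB (vertex v)) dotpNr mulNr [dotp _ _ * _]mulrC.
have sE : size (enum K) = m.+2 by rewrite -cardE.
have [x0 x0K] : exists x0, x0 \in K by apply/set0Pn; rewrite -card_gt0 cardK.
have EE : edge_mx m.+1 (points (enum K)) *m (L - N)^T = 0.
  apply/row_matrixP => i; rewrite row_mul row0 rowK; apply/rowP => j.
  rewrite (ord1 j) -dotpE mxE dotpBr.
  have pE k : (k < m.+2)%N -> points (enum K) k = vertex (nth x0 (enum K) k).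
    by move=> km; rewrite (points_nth x0)// sE.
  have mE k : (k < m.+2)%N -> nth x0 (enum K) k \in K.
    by move=> km; rewrite -mem_enum mem_nth// sE.
  have im : (i.+1 < m.+2)%N by rewrite ltnS ltn_ord.
  by rewrite !pE// edge ?subrr//; exact: mE.
have uE : edge_mx m.+1 (points (enum K)) \in unitmx.
  by rewrite unitmxE unitfE; exact: (det_listing_neq0 cardK freeK (perm_refl _)).
apply/eqP; rewrite -subr_eq0; apply/eqP.
by rewrite -[LHS]trmxK -(mulKmx uE (L - N)^T) EE mulmx0 trmx0.
Qed.

(** The terms of the discrete continuity equation that belong to one cell. *)
Lemma cell_integration_by_parts (u : 'rV[R]_m.+1 -> 'rV[R]_m.+1) q :
  (forall i, polyf (fun x => u x ord0 i)) -> polyf q ->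
  vol_integral (hull K) (fun x => dotp (u x) (gradient q x)) -
  \sum_(v in K) facet_integral (K :\ v) setT
    (fun x => dotp (u x) (normal K (K :\ v)) * q x) =
  - vol_integral (hull K) (fun x => divergence u x * q x).
Proof.
move=> pu pq.
have puq j : polyf (fun x => u x ord0 j * q x) by exact: polyfM.
have -> : \sum_(v in K) facet_integral (K :\ v) setT
    (fun x => dotp (u x) (normal K (K :\ v)) * q x) =
    \sum_j vol_integral (hull K) ('D_('e_j) (fun x => u x ord0 j * q x)).
  rewrite (eq_bigr _ (fun j _ => cell_integral_derive 'e_j (puq j))) exchange_big.
  apply: eq_bigr => v _; rewrite -facet_integral_sum; last first.
    by move=> j; apply: polyfM => //; exact: polyf_cst.
  congr facet_integral; apply/funext => x; rewrite mulr_suml; apply: eq_bigr => j _.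
  rewrite dotpE -rowE !mxE mulrA; congr (_ * _); exact: mulrC.
have pdu j : polyf ('D_('e_j) (fun x => u x ord0 j)) by exact: polyf_derive.
have pdq j : polyf ('D_('e_j) q) by exact: polyf_derive.
rewrite -cell_integral_sum; last by move=> j; exact: polyf_derive.
have E : (fun x => \sum_j 'D_('e_j) (fun y => u y ord0 j * q y) x) =
    (fun x => dotp (u x) (gradient q x) + divergence u x * q x).
  apply/funext => x; rewrite /dotp /divergence mulr_suml -big_split /=.
  apply: eq_bigr => j _; rewrite mxE deriveM; last 2 first.
  - exact: (polyf_derivable (pu j) 'e_j).1.
  - exact: (polyf_derivable pq 'e_j).1.
  by congr (_ + _); exact: mulrC.
rewrite E cell_integralD; first by rewrite opprD addNKr.
- apply: polyf_sum => j; apply: polyfM => //.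
  by rewrite (_ : (fun x => _) = 'D_('e_j) q)//; apply/funext => x; rewrite mxE.
- by apply: polyfM => //; apply: polyf_sum.
Qed.

End green.

(** * Barycentric coordinates and neighbouring cells *)

Section barycentric_coordinates.
Context {R : realType} {m : nat} (M : mesh R m.+1).
Notation vset := {set 'I_(nvertex M)}.
Notation RT := (measurableTypeR R).
Implicit Types (K L F : vset) (x : 'rV[R]_m.+1).

(** The barycentric coordinate of [x] with respect to the vertex [i] of [K], an
    affine function on the whole space; it is set to 0 when [i] is not in [K]. *)
Definition coord K i x : R :=
  if insub (index i (enum K)) : option 'I_m.+2 is Some k
  then bary (tp ((x - points (enum K) 0) *m invmx (edge_mx m.+1 (points (enum K))))) k
  else 0.

(** The condition on the vertex set of a cell: it spans a nondegenerate simplex of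
    full dimension m+1. *)
Definition simplicial K := #|K| = m.+2 /\ affinely_independent K.

Lemma polyf_coordK K i : polyf (coord K i).
Proof.
rewrite /coord; case: insubP => [k _ _|_]; last exact: polyf_cst.
set A := invmx _.
have P j : polyf (fun x => tnth (tp ((x - points (enum K) 0) *m A)) j : R).
  rewrite (_ : (fun _ => _) = fun x => (x *m A + - points (enum K) 0 *m A) ord0 j).
    apply: (@polyf_affine _ _ _ A (- points (enum K) 0 *m A) (fun y => y ord0 j)).
    exact: polyf_coord.
  by apply/funext => x; rewrite tnth_mktuple mulmxBl mulNmx.
rewrite /bary; case: unliftP => [j _|_]; first exact: P.
apply: polyfB; first exact: polyf_cst.
exact: polyf_sum.
Qed.

Section one_cell.
Variable K : vset.
Hypothesis cK : simplicial K.

Let sizeK : size (enum K) = m.+2.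
Proof. by rewrite -cardE cK.1. Qed.

Lemma coord_nth (x0 : 'I_(nvertex M)) (k : 'I_m.+2) x : coord K (nth x0 (enum K) k) x =
  bary (tp ((x - points (enum K) 0) *m invmx (edge_mx m.+1 (points (enum K))))) k.
Proof.
rewrite /coord index_uniq ?enum_uniq ?sizeK//.
by case: insubP => [j _ jk|]; [congr bary; apply/val_inj|rewrite ltn_ord].
Qed.

Let inhK : exists i0, i0 \in K.
Proof. by apply/set0Pn; rewrite -card_gt0 cK.1. Qed.

Lemma sum_coord x : \sum_(i in K) coord K i x = 1.
Proof.
have [x0 _] := inhK; rewrite (big_listing x0 _ (perm_refl (enum K)) sizeK).
by rewrite (eq_bigr _ (fun k _ => coord_nth x0 k x)) sum_bary.
Qed.

Lemma coord_combination x : \sum_(i in K) coord K i x *: vertex i = x.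
Proof.
have [x0 _] := inhK; rewrite (big_listing x0 _ (perm_refl (enum K)) sizeK).
set t := tp ((x - points (enum K) 0) *m invmx (edge_mx m.+1 (points (enum K)))).
transitivity (simplex_param (points (enum K)) t).
  rewrite simplex_param_bary; apply: eq_bigr => k _.
  have kE : (k < size (enum K))%N by rewrite -cardE cK.1.
  by rewrite coord_nth (points_nth x0 kE).
rewrite /simplex_param tpK mulmxKV ?subrK// unitmxE unitfE.
exact: (det_listing_neq0 cK.1 cK.2 (perm_refl _)).
Qed.

Lemma coord_unique (w : 'I_(nvertex M) -> R) x : \sum_(i in K) w i = 1 ->
  \sum_(i in K) w i *: vertex i = x -> forall i, i \in K -> w i = coord K i x.
Proof.
move=> w1 wx i iK; apply/eqP; rewrite -subr_eq0; apply/eqP.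
apply: (cK.2 (fun i => w i - coord K i x)) => //.
  by rewrite sumrB w1 sum_coord subrr.
under eq_bigr do rewrite scalerBl.
by rewrite sumrB wx coord_combination subrr.
Qed.

Lemma coord_affine (I : finType) (P : pred I) (c : I -> R) (y : I -> 'rV[R]_m.+1) i :
  i \in K -> \sum_(j | P j) c j = 1 ->
  coord K i (\sum_(j | P j) c j *: y j) = \sum_(j | P j) c j * coord K i (y j).
Proof.
move=> iK c1; symmetry.
apply: (@coord_unique (fun i => \sum_(j | P j) c j * coord K i (y j))) => //.
  rewrite exchange_big -[RHS]c1; apply: eq_bigr => j _.
  by rewrite -mulr_sumr sum_coord mulr1.
under eq_bigr do rewrite scaler_suml.
rewrite exchange_big; apply: eq_bigr => j _ /=.
under eq_bigr do rewrite -scalerA.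
by rewrite -scaler_sumr coord_combination.
Qed.

Lemma coord_vertex i j : i \in K -> j \in K -> coord K i (vertex j) = (i == j)%:R.
Proof.
move=> iK jK; symmetry; apply: (@coord_unique (fun i => (i == j)%:R)) => //.
  by rewrite (bigD1 j)//= eqxx big1 ?addr0// => k /andP[_ /negPf->].
rewrite (bigD1 j)//= eqxx scale1r big1 ?addr0// => k /andP[_ /negPf->].
by rewrite scale0r.
Qed.

Lemma hull_coordP x : hull K x <-> forall i, i \in K -> 0 <= coord K i x.
Proof.
split=> [[w [w0 w1 xE]] i iK|h].
  by rewrite -(coord_unique w1 (esym xE)).
exists (fun i => if i \in K then coord K i x else 0); split.
- by move=> i; case: ifP => // /h.
- by rewrite -[RHS](sum_coord x); apply: eq_bigr => i ->.
- by rewrite -[LHS]coord_combination; apply: eq_bigr => i ->.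
Qed.

End one_cell.

Section two_cells.
Variables (K L F : vset) (a b : 'I_(nvertex M)).
Hypotheses (cK : simplicial K) (cL : simplicial L).
Hypotheses (aK : a \in K) (bL : b \in L) (FK : F = K :\ a) (FL : F = L :\ b).

Let cardF : #|F| = m.+1.
Proof. by have := cardsD1 a K; rewrite aK cK.1 add1n FK => -[]. Qed.

Let FsubK i : i \in F -> i \in K. Proof. by rewrite FK => /setD1P[]. Qed.
Let FsubL i : i \in F -> i \in L. Proof. by rewrite FL => /setD1P[]. Qed.

(** The coordinates that vanish on the common facet are proportional; the sign of
    the factor tells whether [K] and [L] lie on the same side of the facet. *)
Lemma apex_coord x : coord L b x = coord K a x * coord L b (vertex a).
Proof.
rewrite -{1}(coord_combination cK x) (coord_affine cL)//; last exact: sum_coord.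
rewrite (bigD1 a)//= big1 ?addr0// => i /andP[iK ia].
have iF : i \in F by rewrite FK in_setD1 ia.
rewrite (coord_vertex cL)// ?FsubL// (_ : b == i = false) ?mulr0//.
by apply/negbTE/eqP => bi; move: iF; rewrite FL -bi in_setD1 eqxx.
Qed.

Lemma apex_coord_neq0 : coord L b (vertex a) != 0.
Proof.
have := apex_coord (vertex b); rewrite (coord_vertex cL)// eqxx => /eqP.
by apply: contraL => /eqP ->; rewrite mulr0 oner_eq0.
Qed.

(** Cells that meet in the common facet only lie on opposite sides of it: if they
    were on the same side, the barycentre of the facet moved slightly towards [a]
    would be in both. *)
Lemma apex_coord_lt0 : hull K `&` hull L = hull F -> coord L b (vertex a) < 0.
Proof.
move=> KL; rewrite lt_neqAle apex_coord_neq0 leNgt; apply/negP => s0.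
pose c i := coord L i (vertex a).
pose C := \sum_(i in L) `|c i|.
have C0 : 0 <= C by rewrite sumr_ge0.
pose d : R := m.+1%:R.
have d0 : 0 < d by rewrite ltr0n.
have dC0 : 0 < 1 + d * C by rewrite ltr_wpDr// mulr_ge0// ltW.
(* Small enough for the coordinates of the moved point with respect to [L] to
   stay nonnegative. *)
pose e := (1 + d * C)^-1.
have e0 : 0 < e by rewrite invr_gt0.
have eE : 1 - e = e * (d * C).
  apply: (mulfI (lt0r_neq0 dC0)); rewrite mulrA mulrBr mulr1 divff ?gt_eqF//.
  by rewrite mul1r addrAC subrr add0r.
pose w i : R := if i == a then e else (1 - e) / d.
have w1 : \sum_(i in K) w i = 1.
  rewrite (bigD1 a)//= {1}/w eqxx (eq_bigr (fun=> (1 - e) / d)) => [|i /andP[_ /negPf ia]]; last first.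
    by rewrite /w ia.
  rewrite (eq_bigl (fun i => i \in F)) => [|i]; last by rewrite FK in_setD1 andbC.
  rewrite sumr_const cardF -[_ *+ _]mulr_natr divfK ?gt_eqF//.
  by rewrite addrC subrK.
pose x := \sum_(i in K) w i *: vertex i.
have xK i : i \in K -> coord K i x = w i by move=> iK; rewrite -(coord_unique cK w1 erefl).
have hK : hull K x.
  apply/(hull_coordP cK) => i iK; rewrite xK// /w; case: ifP => _; first exact: ltW.
  by rewrite eE; apply: mulr_ge0; [apply: mulr_ge0|rewrite invr_ge0]; rewrite ?mulr_ge0// ltW.
have hL : hull L x.
  apply/(hull_coordP cL) => i iL; have [->|ib] := eqVneq i b.
    by rewrite apex_coord xK// /w eqxx mulr_ge0// ltW.
  have iF : i \in F by rewrite FL in_setD1 ib.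
  have ia : (i == a) = false.
    by apply/negbTE/eqP => ia; move: iF; rewrite FK ia in_setD1 eqxx.
  rewrite /x (coord_affine cL)// (bigD1 a)//= (bigD1 i) ?FsubK//=; last first.
    by rewrite ia.
  rewrite big1 ?addr0; last first.
    move=> j /andP[/andP[jK ja] ji].
    have jF : j \in F by rewrite FK in_setD1 ja.
    by rewrite (coord_vertex cL)// ?FsubL// [i == j]eq_sym (negPf ji) mulr0.
  have -> : w a = e by rewrite /w eqxx.
  have -> : w i = (1 - e) / d by rewrite /w ia.
  rewrite (coord_vertex cL iL iL) eqxx mulr1 eE -/(c i).
  rewrite [d * C]mulrC !mulrA mulfK ?gt_eqF// -mulrDr mulr_ge0//; first exact: ltW.
  have cC : `|c i| <= C by rewrite /C (bigD1 i)//= lerDl sumr_ge0.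
  by have := ler_norm (- c i); rewrite normrN; lra.
have : hull F x by rewrite -KL.
move=> [u [u0 u1 xE]].
have aF : a \notin F by rewrite FK in_setD1 eqxx.
pose u' i := if i \in F then u i else 0.
have KF (V : zmodType) (G : 'I_(nvertex M) -> V) : G a = 0 ->
    \sum_(i in K) G i = \sum_(i in F) G i.
  by move=> Ga; rewrite (bigD1 a)//= Ga add0r FK; apply: eq_bigl => i; rewrite in_setD1 andbC.
have := @coord_unique K cK u' x _ _ a aK.
rewrite {3}/u' (negPf aF) xK// /w eqxx => ue.
suff : 0 = e by move=> e00; rewrite -e00 ltxx in e0.
apply: ue.
  rewrite KF ?/u' ?(negPf aF)// -[RHS]u1; by apply: eq_bigr => i ->.
rewrite KF ?/u' ?(negPf aF) ?scale0r// xE; by apply: eq_bigr => i ->.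
Qed.

(** Near the barycentre of the common facet, each point is in one of the two cells,
    according to its side. *)
Lemma common_facet_interior : hull K `&` hull L = hull F ->
  exists2 x, hull F x & nbhs x (hull K `|` hull L).
Proof.
move=> KL; have s0 := apex_coord_lt0 KL.
pose d : R := m.+1%:R.
have d0 : 0 < d by rewrite ltr0n.
pose x := \sum_(i in F) d^-1 *: vertex i.
have w1 : \sum_(i in F) d^-1 = 1.
  by rewrite sumr_const cardF -[_ *+ _]mulr_natr mulVf// gt_eqF.
have center (G : vset) : simplicial G -> {subset F <= G} -> forall i, i \in F ->
    \forall y \near x, 0 < coord G i y.
  move=> cG FG i iF.
  have xi : coord G i x = d^-1.
    rewrite /x (coord_affine cG)//; last exact: FG.
    rewrite (bigD1 i)//= big1 ?addr0 => [|j /andP[jF ji]]; rewrite (coord_vertex cG)//; try exact: FG.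
      by rewrite eqxx mulr1.
    by rewrite eq_sym (negPf ji) mulr0.
  have : coord G i @ x --> coord G i x by exact: (polyf_continuous (polyf_coordK G i)).
  move=> /(@cvgr_gt _ _ _ _ _ _) /(_ 0); apply.
  by rewrite xi invr_gt0.
exists x.
  exists (fun=> d^-1); split => //.
  by move=> _; rewrite invr_ge0 ltW.
have FF (G : vset) : simplicial G -> {subset F <= G} ->
    \forall y \near x, forall i, i \in F -> 0 < coord G i y.
  move=> cG FG.
  apply: (@filter_forall _ _ (fun i y => i \in F -> 0 < coord G i y) _
    (nbhs_filter x)) => i.
  have [iF|iF] := boolP (i \in F).
    by apply: filterS (center G cG FG i iF) => y.
  by near=> y.
near=> y.
have yK : forall i, i \in F -> 0 < coord K i y by near: y; exact: (FF K cK FsubK).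
have yL : forall i, i \in F -> 0 < coord L i y by near: y; exact: (FF L cL FsubL).
have [ya|ya] := leP 0 (coord K a y); [left|right].
  apply/(hull_coordP cK) => i iK; have [->//|ia] := eqVneq i a.
  by apply/ltW/yK; rewrite FK in_setD1 ia.
apply/(hull_coordP cL) => i iL; have [->|ib] := eqVneq i b.
  by rewrite apex_coord mulr_le0// ltW.
by apply/ltW/yL; rewrite FL in_setD1 ib.
Unshelve. all: by end_near. Qed.

End two_cells.

End barycentric_coordinates.

(** * Facets of a triangulation *)

Section triangulation_facets.
Context {R : realType} {m : nat} (M : mesh R m.+1) (Omega : set 'rV[R]_m.+1).
Notation vset := {set 'I_(nvertex M)}.
Local Notation ref m := (@ref_simplex R m).
Hypothesis hM : triangulation M Omega.
Implicit Types (K L P F : vset) (a b c v w : 'I_(nvertex M)).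

Lemma cell_simplicial K : K \in cells M -> simplicial K.
Proof. by move=> KM; have [_ H _ _] := hM; exact: H. Qed.

Lemma same_facetI K L a b : K \in cells M -> L \in cells M -> K != L ->
  a \in K -> b \in L -> K :\ a = L :\ b -> K :&: L = K :\ a.
Proof.
move=> KM LM KL aK bL KaLb; have [cK _] := cell_simplicial KM.
have [cL _] := cell_simplicial LM.
have subL i : i \in K -> i != a -> i \in L.
  move=> iK ia; have : i \in L :\ b by rewrite -KaLb in_setD1 ia.
  by case/setD1P.
apply/setP => i; rewrite finset.in_setI in_setD1 andbC.
have [->|ia] := eqVneq i a; last by case: (boolP (i \in K)) => iK; rewrite ?andbF// subL.
apply/negbTE/negP => /andP[aL _]; move/negP: KL; apply.
rewrite eqEcard cK cL leqnn andbT; apply/fintype.subsetP => j jK.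
by have [->//|ja] := eqVneq j a; exact: subL.
Qed.

Lemma facet_of_cells K L : K \in cells M -> L \in cells M -> K != L ->
  #|K :&: L| = m.+1 ->
  exists a b, [/\ a \in K, b \in L, K :&: L = K :\ a & K :&: L = L :\ b].
Proof.
have half P Q : P \in cells M -> #|P :&: Q| = m.+1 -> exists2 a, a \in P & P :&: Q = P :\ a.
  move=> /cell_simplicial[cP _] PQ.
  have /cards1P[a aE] : #|P :\: Q| == 1%N by rewrite cardsD cP PQ subSnn.
  have : a \in P :\: Q by rewrite aE set11.
  case/setDP => aP aQ; exists a => //; rewrite -aE.
  by apply/setP => i; rewrite !inE; case: (i \in P); case: (i \in Q).
move=> KM LM _ cF; have [a aK aE] := half _ _ KM cF.
rewrite finset.setIC in cF; have [b bL bE] := half _ _ LM cF.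
by exists a, b; split => //; rewrite finset.setIC.
Qed.

(** Near the barycentre of a facet shared by two cells, the space is covered by
    these cells. So this point is interior to the closure of [Omega], whose
    interior is [Omega]. *)
Lemma facet_not_boundary K L a b : K \in cells M -> L \in cells M -> K != L ->
  a \in K -> b \in L -> K :\ a = L :\ b -> ~ (hull (K :\ a) `<=` boundary Omega).
Proof.
move=> KM LM KL aK bL KaLb FB; have [[_ oO _ regO] _ covO inter] := hM.
have hI : hull K `&` hull L = hull (K :\ a).
  by rewrite inter// (same_facetI KM LM KL aK bL KaLb).
have [x hx xI] := common_facet_interior (cell_simplicial KM) (cell_simplicial LM)
  aK bL erefl KaLb hI.
have Ox : Omega x.
  by rewrite regO; apply: filterS xI => y [hK|hL]; rewrite covO; [exists K|exists L].
by have [_] := FB _ hx; apply; exact: open_nbhs_nbhs.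
Qed.

(** Three cells with a common facet would be pairwise on opposite sides of it. *)
Lemma at_most_two_cells K L P a b c :
  K \in cells M -> L \in cells M -> P \in cells M -> K != L -> P != K -> P != L ->
  a \in K -> b \in L -> c \in P -> K :\ a = L :\ b -> P :\ c <> K :\ a.
Proof.
move=> KM LM PM KL PK PL aK bL cP KaLb PcKa.
have [_ _ _ inter] := hM.
have sK := cell_simplicial KM; have sL := cell_simplicial LM; have sP := cell_simplicial PM.
have hKL : hull K `&` hull L = hull (K :\ a).
  by rewrite inter// (same_facetI KM LM KL aK bL KaLb).
have hKP : hull K `&` hull P = hull (K :\ a).
  by rewrite inter// (@same_facetI K P a c)// eq_sym.
have hLP : hull L `&` hull P = hull (L :\ b).
  by rewrite inter// (@same_facetI L P b c)// 1?eq_sym// -KaLb.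
have l1 := apex_coord_lt0 sK sL aK bL erefl KaLb hKL.
have l2 := apex_coord_lt0 sK sP aK cP erefl (esym PcKa) hKP.
have l3 := apex_coord_lt0 sL sP bL cP erefl (etrans (esym KaLb) (esym PcKa)) hLP.
have := apex_coord sL sP bL cP erefl (etrans (esym KaLb) (esym PcKa)) (vertex a).
by move=> e; move: l2; rewrite e nmulr_llt0// ltNge ltW.
Qed.

Lemma facet_area_gt0 K a : K \in cells M -> a \in K ->
  0 < Num.sqrt (\det (facet_gram (K :\ a))).
Proof.
move=> /cell_simplicial[cK fK] aK; have jac0 := cell_jac_gt0 cK fK.
have : (0 < #|K :\ a|)%N.
  by have := cardsD1 a K; rewrite aK cK add1n => -[<-].
rewrite card_gt0 => /set0Pn[w wF].
have := cell_jac_normal cK fK aK wF => jE.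
rewrite lt_neqAle sqrtr_ge0 andbT eq_sym; apply/eqP => s0.
by move: jac0; rewrite jE s0 mul0r ltxx.
Qed.

Lemma facet_hull_param K a x : K \in cells M -> a \in K ->
  hull (K :\ a) x <-> exists2 t, ref m t & x = simplex_param (facet_point (K :\ a)) t.
Proof.
move=> /cell_simplicial[cK _] aK; apply: hull_param; first exact: perm_refl.
by rewrite -cardE; have := cardsD1 a K; rewrite aK cK add1n => -[].
Qed.

Lemma eq_facet_integral K a g g' : K \in cells M -> a \in K ->
  (forall x, hull (K :\ a) x -> g x = g' x) ->
  facet_integral (K :\ a) setT g = facet_integral (K :\ a) setT g'.
Proof.
move=> KM aK gg; rewrite !facet_integral_setT; congr (_ * _).
apply: eq_Rintegral => t /set_mem rt; apply: gg.
by apply/(facet_hull_param _ KM aK); exists t.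
Qed.

Lemma facet_integral_sqr_eq0 K a g : K \in cells M -> a \in K -> polyf g ->
  facet_integral (K :\ a) setT (fun x => g x ^+ 2) = 0 ->
  forall x, hull (K :\ a) x -> g x = 0.
Proof.
move=> KM aK pg /eqP; rewrite facet_integral_setT mulf_eq0.
rewrite gt_eqF/=; last exact: facet_area_gt0.
move=> /eqP I0 x /(facet_hull_param _ KM aK)[t rt ->].
exact: (integral_ref_sqr_eq0 (polyf_param m (facet_point (K :\ a)) pg) I0).
Qed.

Lemma cell_integral_sqr_eq0 K g : K \in cells M -> polyf g ->
  vol_integral (hull K) (fun x => g x ^+ 2) = 0 -> forall x, hull K x -> g x = 0.
Proof.
move=> KM pg; have [cK fK] := cell_simplicial KM.
have [_ ->] := cell_integral_param cK fK (perm_refl _) (polyfX 2 pg).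
move=> /eqP; rewrite mulf_eq0 normr_eq0 (negPf (det_listing_neq0 cK fK (perm_refl _))) /=.
move=> /eqP I0 x; have sE : size (enum K) = m.+2 by rewrite -cardE.
move=> /(hull_param _ (perm_refl _) sE)[t rt ->].
exact: (integral_ref_sqr_eq0 (polyf_param m.+1 (points (enum K)) pg) I0).
Qed.

End triangulation_facets.

(** * Discrete solutions *)

Section solution.
Context {R : realType} {m : nat} (M : mesh R m.+1) (Omega : set 'rV[R]_m.+1).
Notation vset := {set 'I_(nvertex M)}.
Hypothesis hM : triangulation M Omega.
Implicit Types (K L F : vset) (a b v : 'I_(nvertex M)).

Let vol_integral0 (D : set 'rV[R]_m.+1) : vol_integral D (fun=> 0) = 0.
Proof. by rewrite /vol_integral /Rintegral integral0. Qed.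

Let facet_integral0 F (D : set 'rV[R]_m.+1) : facet_integral F D (fun=> 0) = 0.
Proof. by rewrite /facet_integral /Rintegral integral0 mulr0. Qed.

(** Test the continuity equation with the divergence on [K], extended by zero. *)
Lemma divergence_free k (s1 : state M) : in_Vh k.+1 (vel s1) -> continuity_eq k.+1 s1 ->
  forall K, K \in cells M -> forall x, hull K x -> divergence (vel s1 K) x = 0.
Proof.
move=> hV hC K KM; have [cK fK] := cell_simplicial hM KM.
have pu i : polyf (fun x => vel s1 K x ord0 i) by exact: poly_fun_polyf (hV K KM i).
have pd : poly_fun k (divergence (vel s1 K)).
  by apply: poly_fun_sum => i; apply: poly_fun_derive; exact: hV.
apply: (cell_integral_sqr_eq0 hM KM (poly_fun_polyf pd)).
pose q : cell_scalar M := fun L => if L == K then divergence (vel s1 K) else fun=> 0.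
have hq : in_Qh k.+1 q.
  by move=> L LM; rewrite /q; case: eqP => _ //; exact: poly_fun0.
have := hC q hq; rewrite /cell_integrals /cell_boundary_integrals.
have qK : q K = divergence (vel s1 K) by rewrite /q eqxx.
rewrite (bigD1 K)//= big1 ?addr0; last first.
  move=> L /andP[_ /negPf LK]; rewrite -[RHS](vol_integral0 (hull L)).
  congr vol_integral; apply/funext => x; rewrite /q LK.
  apply: big1 => j _; rewrite mxE derive_cst mulr0.
  by [].
rewrite (bigD1 K KM) /= [X in _ - (_ + X)]big1 ?addr0; last first.
  move=> L /andP[_ /negPf LK]; apply: big1 => v _.
  rewrite -[RHS](facet_integral0 (L :\ v) setT).
  by congr facet_integral; apply/funext => x; rewrite /q LK mulr0.
rewrite qK (cell_integration_by_parts cK fK pu (poly_fun_polyf pd)).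
by move=> /eqP; rewrite eq_sym oppr_eq0 => /eqP.
Qed.

(* The flux equation tested with [qb], which is [g] on the facet [F] and 0 on the
   other facets: only the cells that contain [F] contribute. *)
Section flux.
Variables (k : nat) (s1 : state M) (F : vset) (g : 'rV[R]_m.+1 -> R).

Let qb : facet_scalar M := fun F' => if F' == F then g else fun=> 0.

Let flux K := \sum_(v in K) facet_integral (K :\ v) setT
  (fun x => dotp (vel s1 K x) (normal K (K :\ v)) * qb (K :\ v) x).

Let flux_facet K a : a \in K -> K :\ a = F ->
  flux K = facet_integral F setT (fun x => dotp (vel s1 K x) (normal K F) * g x).
Proof.
move=> aK KaF; rewrite /flux (bigD1 a)//= KaF /qb eqxx big1 ?addr0// => v /andP[vK va].
have /negPf -> : K :\ v != F.
  apply: contra_neq va => KvF; apply/eqP; apply: contraT => va.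
  have : v \in K :\ a by rewrite in_setD1 va.
  by rewrite KaF -KvF in_setD1 eqxx.
rewrite -[RHS](facet_integral0 (K :\ v) setT).
by congr facet_integral; apply/funext => x; rewrite mulr0.
Qed.

Let flux_other K : (forall v, v \in K -> K :\ v <> F) -> flux K = 0.
Proof.
move=> KF; apply: big1 => v vK; rewrite /qb.
have /eqP/negPf -> := KF v vK; rewrite -[RHS](facet_integral0 (K :\ v) setT).
by congr facet_integral; apply/funext => x; rewrite mulr0.
Qed.

Hypothesis hF : normal_flux_eq Omega k s1.

Let qb_in : poly_on k (hull F) g -> in_Qbarh Omega k qb.
Proof.
move=> pg F' _; rewrite /qb; have [->//|_] := eqVneq F' F.
by exists (fun=> 0) => //; exact: poly_fun0.
Qed.

Lemma flux_interior K L a b : K \in cells M -> L \in cells M -> K != L ->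
  a \in K -> b \in L -> K :\ a = F -> L :\ b = F -> poly_on k (hull F) g ->
  facet_integral F setT (fun x => dotp (vel s1 K x) (normal K F) * g x) +
  facet_integral F setT (fun x => dotp (vel s1 L x) (normal L F) * g x) = 0.
Proof.
move=> KM LM KL aK bL KaF LbF pg.
have KaLb : K :\ a = L :\ b by rewrite KaF.
have := hF (qb_in pg); rewrite /boundary_integral [X in _ - X]big1 ?subr0; last first.
  move=> P PM; apply: big1 => v /andP[vP /asboolP vB].
  rewrite -[RHS](facet_integral0 (P :\ v) setT).
  congr facet_integral; apply/funext => x; rewrite /qb ifF ?mulr0//.
  apply/negbTE/eqP => PvF; have := facet_not_boundary hM KM LM KL aK bL KaLb.
  by apply; rewrite KaF -PvF.
have LK : (L \in cells M) && (L != K) by rewrite LM eq_sym.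
have sumE : \sum_(P in cells M) flux P = flux K + flux L.
  rewrite (bigD1 K KM) (bigD1 L LK) /=; congr (_ + _).
  rewrite -[RHS]addr0; congr (_ + _); apply: big1 => P /andP[/andP[PM PK] PL].
  apply: flux_other => v vP PvF.
  by apply: (@at_most_two_cells _ _ _ _ hM K L P a b v) => //; rewrite KaF.
move=> h; have := etrans h sumE.
by rewrite (flux_facet aK KaF) (flux_facet bL LbF) => <-.
Qed.

Lemma flux_boundary K a : K \in cells M -> a \in K -> K :\ a = F ->
  hull F `<=` boundary Omega -> poly_on k (hull F) g ->
  facet_integral F setT (fun x => dotp (vel s1 K x) (normal K F) * g x) =
  facet_integral F setT (fun x => dotp (vbar s1 F x) (normal K F) * g x).
Proof.
move=> KM aK KaF FB pg.
have other P : P \in cells M -> P != K -> forall v, v \in P -> P :\ v <> F.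
  move=> PM PK v vP PvF; apply: (@facet_not_boundary _ _ _ _ hM K P a v) => //.
  - by rewrite eq_sym.
  - by rewrite KaF.
  - by rewrite KaF.
have := hF (qb_in pg); move/eqP; rewrite eq_sym subr_eq0 => /eqP.
have sumE : \sum_(P in cells M) flux P = flux K.
  by apply: (big_only1 K) => // P PK PM; apply: flux_other; exact: other.
move=> h; have := etrans (esym sumE) h; rewrite (flux_facet aK KaF) => ->.
rewrite /boundary_integral (big_only1 K KM) => [|P PK PM]; last first.
  apply: big1 => v /andP[vP _].
  rewrite -[RHS](facet_integral0 (P :\ v) setT).
  congr facet_integral; apply/funext => x; rewrite /qb ifF ?mulr0//.
  by apply/negbTE/eqP; exact: other.
have aB : (a \in K) && `[< hull (K :\ a) `<=` boundary Omega >].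
  by rewrite aK KaF asboolT.
rewrite (big_only1 a aB) => [|v va /andP[vK _]]; last first.
  rewrite -[RHS](facet_integral0 (K :\ v) setT).
  congr facet_integral; apply/funext => x; rewrite /qb ifF ?mulr0//.
  apply: contra_neqF va => /eqP KvF; apply/eqP; apply: contraT => va.
  have : v \in K :\ a by rewrite in_setD1 va.
  by rewrite KaF -KvF in_setD1 eqxx.
by rewrite /qb KaF eqxx.
Qed.

End flux.

Let poly_fun_dotp k (u : 'rV[R]_m.+1 -> 'rV[R]_m.+1) c :
  (forall i, poly_fun k (fun x => u x ord0 i)) -> poly_fun k (fun x => dotp (u x) c).
Proof.
move=> pu; apply: poly_fun_sum => i.
rewrite (_ : (fun _ => _) = fun x => c ord0 i * u x ord0 i); first exact: poly_funZ.
by apply/funext => x; rewrite mulrC.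
Qed.

(** Test the flux equation with the jump on [F], extended by zero. *)
Lemma jump_eq0 k (s1 : state M) : in_Vh k (vel s1) -> normal_flux_eq Omega k s1 ->
  forall K L F, K \in cells M -> L \in cells M -> K != L -> F = K :&: L ->
  interior_facet F -> forall x, hull F x -> jump (vel s1) K L F x = 0.
Proof.
move=> hV hF K L F KM LM KL FE [_ [_ [_ _ _ _ cF]]].
rewrite FE in cF; have [a [b [aK bL KaE LbE]]] := facet_of_cells hM KM LM KL cF.
rewrite -FE in KaE LbE.
pose uK x := dotp (vel s1 K x) (normal K F).
pose uL x := dotp (vel s1 L x) (normal L F).
have pK : poly_fun k uK by apply: poly_fun_dotp; exact: hV.
have pL : poly_fun k uL by apply: poly_fun_dotp; exact: hV.
have pJ : poly_fun k (fun x => uK x + uL x) by exact: poly_funD.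
have pqK := poly_fun_polyf pK; have pqL := poly_fun_polyf pL.
have pqJ := poly_fun_polyf pJ.
rewrite KaE; apply: (facet_integral_sqr_eq0 hM KM aK); first by rewrite -KaE.
rewrite -KaE.
have pJF : poly_on k (hull F) (fun x => uK x + uL x) by exists (fun x => uK x + uL x).
have := flux_interior hF KM LM KL aK bL (esym KaE) (esym LbE) pJF; apply: etrans.
rewrite !facet_integralE -mulrDr -ref_integralD.
- congr (_ * ref_integral _); apply/funext => y; rewrite expr2; exact: mulrDl.
- by apply: (polyf_affine _ _ (polyfM pqK pqJ)).
- by apply: (polyf_affine _ _ (polyfM pqL pqJ)).
Qed.

(** Test the flux equation with the difference of the two normal traces. *)
Lemma boundary_normal_trace k (GD : set 'rV[R]_m.+1) (s1 : state M) :
  in_Vh k (vel s1) -> in_Vbarh Omega k GD (vbar s1) -> normal_flux_eq Omega k s1 ->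
  forall K v, K \in cells M -> v \in K -> boundary_facet Omega (K :\ v) ->
  forall x, hull (K :\ v) x ->
  dotp (vel s1 K x) (normal K (K :\ v)) = dotp (vbar s1 (K :\ v) x) (normal K (K :\ v)).
Proof.
move=> hV [hVb _] hF K v KM vK bF; set F := K :\ v; set n := normal K F.
have FB : hull F `<=` boundary Omega by have [K' [v' [_ _ _]]] := bF.
(* [vbar s1 F] is polynomial on the facet only; use a polynomial extension. *)
have [p hp] : exists p : 'I_m.+1 -> 'rV[R]_m.+1 -> R, forall i,
    poly_fun k (p i) /\ forall x, hull F x -> vbar s1 F x ord0 i = p i x.
  have h i := hVb F (or_intror bF) i.
  exists (fun i => projT1 (cid2 (h i))) => i.
  by case: (cid2 (h i)).
pose u x := dotp (vel s1 K x) n.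
pose ub (x : 'rV[R]_m.+1) : R := dotp (\row_i p i x) n.
have ubE x : hull F x -> dotp (vbar s1 F x) n = ub x.
  by move=> Fx; apply: eq_bigr => i _; rewrite mxE (hp i).2.
have pu : poly_fun k u by apply: poly_fun_dotp; exact: hV.
have pub : poly_fun k ub.
  apply: poly_fun_dotp => i.
  by rewrite (_ : (fun x => _) = p i); [exact: (hp i).1|apply/funext => x; rewrite mxE].
pose g x := u x + -1 * ub x.
have pg : poly_fun k g by apply: poly_funD => //; exact: poly_funZ.
have [pqu pqub pqg] := And3 (poly_fun_polyf pu) (poly_fun_polyf pub) (poly_fun_polyf pg).
have pgF : poly_on k (hull F) g by exists g.
have fluxE := flux_boundary hF KM vK erefl FB pgF.
have vbE : facet_integral F setT (fun x => dotp (vbar s1 F x) n * g x) =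
           facet_integral F setT (fun x => ub x * g x).
  by apply: (eq_facet_integral hM KM vK) => x Fx; rewrite ubE.
suff g0 x : hull F x -> g x = 0.
  move=> x Fx; have := g0 x Fx; rewrite ubE// /g mulN1r => /eqP.
  by rewrite subr_eq0 => /eqP.
apply: (facet_integral_sqr_eq0 hM KM vK pqg).
have -> : (fun x => g x ^+ 2) = (fun x => u x * g x + -1 * (ub x * g x)).
  by apply/funext => y; rewrite expr2 {1}/g mulrDl mulrA.
rewrite facet_integralE ref_integralD.
- rewrite (ref_integralZ (-1) (polyf_affine _ _ (polyfM pqub pqg))) mulrDr mulrCA.
  rewrite -(facet_integralE F (fun x => u x * g x)).
  rewrite -(facet_integralE F (fun x => ub x * g x)).
  by rewrite mulN1r -vbE fluxE subrr.
- exact: (polyf_affine _ _ (polyfM pqu pqg)).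
- exact: (polyf_affine _ _ (polyfM (polyf_cst _ (-1)) (polyfM pqub pqg))).
Qed.

End solution.

Theorem proposition4 (R : realType) (d : nat) (d23 : d = 2%N \/ d = 3%N)
    (Omega : set 'rV[R]_d) (M : mesh R d) (GD GN : set 'rV[R]_d)
    (hM : triangulation M Omega) (hG : boundary_partition Omega GD GN)
    (k : nat) (k_ge2 : (2 <= k)%N)
    (nu alpha theta : R) (nu_gt0 : 0 < nu) (alpha_gt0 : 0 < alpha)
    (N : nat) (t : nat -> R) (t0 : t 0%N = 0)
    (t_incr : forall m : nat, (m < N)%N -> t m < t m.+1)
    (n : nat) (n_lt : (n < N)%N)
    (f h : 'rV[R]_d -> 'rV[R]_d)
    (hf : L2_domain Omega f) (hh : L2_boundary M Omega GN h)
    (s0 s1 : state M) (hs0 : admissible Omega k GD s0)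
    (hs1 : fully_discrete_solution Omega k GD GN nu alpha theta
             (t n.+1 - t n) f h s0 s1) :
  [/\ forall K, K \in cells M -> forall x, hull K x ->
        divergence (vel s1 K) x = 0,
      forall K L F, K \in cells M -> L \in cells M -> K != L ->
        F = K :&: L -> interior_facet F -> forall x, hull F x ->
        jump (vel s1) K L F x = 0 &
      forall K v, K \in cells M -> v \in K -> boundary_facet Omega (K :\ v) ->
        forall x, hull (K :\ v) x ->
        dotp (vel s1 K x) (normal K (K :\ v)) =
        dotp (vbar s1 (K :\ v) x) (normal K (K :\ v))].
Proof.
have [[hV hVb _ _] [hC hF _ _]] := hs1.
have [m dm] : exists m, d = m.+1 by case: d23 => ->; [exists 1%N|exists 2%N].
subst d; case: k k_ge2 hs0 hs1 hV hVb hC hF => // k _ _ _ hV hVb hC hF.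
split.
- exact: (divergence_free hM hV hC).
- exact: (jump_eq0 hM hV hF).
- exact: (boundary_normal_trace hM hV hVb hF).
Qed.
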